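(* Let $\Omega$ be an infinite compact Hausdorff space and $X$ a (real or complex) Banach space. Let $\Lambda\in \mathrm{WC}(\Omega,X)^*_1$ be a w$^*$-w PC. Then $\Lambda=\sum_{i=1}^{\infty}\alpha_i\,\delta_{\omega_i}\otimes x_i^*$, where $\alpha_i\in(0,1]$ are such that $\sum_{i=1}^\infty\alpha_i=1$, $x_i^*\in X_1^*$ is a w$^*$-w PC (of $X_1^*$) for each $i\in\mathbb{N}$, and each $\omega_i\in\Omega$ is an isolated point of $\Omega$.
   Context: $\mathrm{WC}(\Omega,X)$ is the Banach space of functions $\Omega\to X$ that are continuous when $X$ carries its weak topology, with the supremum norm. For a Banach space $Y$, $Y_1^*$ denotes the closed unit ball of $Y^*$. A point $y^*\in Y_1^*$ is called a w$^*$-w PC (weak$^*$-to-weak point of continuity) if the identity map $(Y_1^*,\text{weak}^* )\to(Y_1^*,\text{weak})$ is continuous at $y^*$, where weak$^*$ is the topology $\sigma(Y^*,Y)$ and weak is $\sigma(Y^*,Y^{**})$. For $\omega\in\Omega$ and $x^*\in X^*$, the functional $\delta_\omega\otimes x^*$ on $\mathrm{WC}(\Omega,X)$ is $(\delta_\omega\otimes x^* )(f)=x^*(f(\omega))$. The points $\omega_i$ are not required to be distinct.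
   Formalization: The Banach space X is assumed to be nonzero; for X = {0} and Ω = [0,1] the functional Λ = 0 is trivially a w*-w PC, but Ω has no isolated points, so the claim as stated fails in that degenerate case. *)

(* Defs.v *)
From HB Require Import structures.
From mathcomp Require Import all_boot all_order all_algebra.
From mathcomp Require Import boolp classical_sets functions cardinality filter.
From mathcomp Require Import reals interval_inference topology normedtype.
From mathcomp Require Import sequences complex ring.

Set Implicit Arguments.
Unset Strict Implicit.
Unset Printing Implicit Defensive.
Import Order.TTheory GRing.Theory Num.Theory.
Import numFieldNormedType.Exports.
Local Open Scope classical_set_scope.
Local Open Scope complex_scope.
Local Open Scope ring_scope.

Inductive real_or_complex : numFieldType -> Prop :=
| RealScalars (R : realType) : real_or_complex R
| ComplexScalars (R : realType) : real_or_complex R[i].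

HB.mixin Record isRealOrComplex K & Num.NumField K := {
  real_or_complexP : real_or_complex K
}.

(* The scalar fields: [R] or [R[i]] for some [R : realType]. *)
#[short(type="scalarFieldType")]
HB.structure Definition ScalarField :=
  {K of isRealOrComplex K & Num.NumField K}.

#[non_forgetful_inheritance]
HB.instance Definition _ (R : realType) :=
  isRealOrComplex.Build R (RealScalars R).
HB.instance Definition _ (R : realType) :=
  isRealOrComplex.Build R[i] (ComplexScalars R).

Lemma real_supremums (K : numFieldType) (A : set K) : real_or_complex K ->
  (forall x, A x -> x \is Num.real) -> A !=set0 -> ubound A !=set0 -> supremums A !=set0.
Proof.
move=> KP; case: K / KP A => R A; first by move=> _ A0 uA; exists (reals.sup A); split;
  [exact/sup_upper_bound|move=> y Ay; exact: ge_sup].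
move=> rA [a Aa] [M uM].
have ReE z : A z -> z = (complex.Re z)%:C.
  by move/rA; rewrite /= => /complex_realP[x ->].
pose B := (@complex.Re R) @` A.
have B0 : B !=set0 by exists (complex.Re a), a.
have uB M' : ubound A M' -> ubound B (complex.Re M').
  by move=> uM' _ [z Az <-]; have := uM' z Az; rewrite lecE => /andP[].
have supB : has_sup B by split=> //; exists (complex.Re M); exact: uB.
exists (reals.sup B)%:C; split=> [z Az|y Ay].
  rewrite (ReE z Az) lecR; apply: sup_upper_bound => //; exact: imageP.
rewrite lecE /=; apply/andP; split.
  by have := Ay a Aa; rewrite lecE (ReE a Aa) => /andP[/eqP -> _].
by apply: ge_sup => //; exact: uB.
Qed.

(* [re z + i * im z] is the Cartesian form of [z]; over the reals [i = 0]. *)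
Lemma cartesian (K : numFieldType) : real_or_complex K ->
  exists (i : K) (re im : K -> K),
  [/\ forall z, z = re z + i * im z,
      forall z, (re z \is Num.real) && (im z \is Num.real),
      forall z, (`|re z| <= `|z|) && (`|im z| <= `|z|),
      forall z w, re (z - w) = re z - re w /\ im (z - w) = im z - im w
    & (forall a b, a \is Num.real -> b \is Num.real -> `|a| <= `|a + i * b|) /\
      ((i = 0 /\ forall z, im z = 0) \/ i * i = -1)].
Proof.
case: K / => R.
  exists 0, id, (fun=> 0); split=> [z|z|z|z w|]; rewrite ?mulr0 ?addr0 ?subr0 //.
  - by rewrite num_real real0.
  - by rewrite normr0 lexx normr_ge0.
  - by split=> [a b _ _|]; [rewrite mul0r addr0|left].
exists 'i, (fun z => 'Re z), (fun z => 'Im z).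
split=> [z|z|z|z w|]; first exact: Crect.
- by rewrite Creal_Re Creal_Im.
- have := leif_normC_Re_Creal z => -[-> _] /=.
  have := leif_normC_Re_Creal ('i * z) => -[+ _].
  by rewrite ReMil normrN normrM normCi mul1r.
- by rewrite !raddfB.
- split=> [a b ar br|]; last by right; rewrite -expr2 sqrCi.
  by have := leif_normC_Re_Creal (a + 'i * b) => -[+ _]; rewrite Re_rect.
Qed.

Lemma scalar_arch (K : numFieldType) (x : K) : real_or_complex K ->
  exists n : nat, `|x| <= n%:R.
Proof.
move=> KP; case: K / KP x => R x.
  by exists (Num.bound `|x|); exact/ltW/archi_boundP.
have /complex_realP[r xr] := normr_real x.
exists (Num.bound `|r|); rewrite xr.
have -> : (Num.bound `|r|)%:R = ((Num.bound `|r|)%:R)%:C :> R[i] by rewrite rmorph_nat.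
rewrite lecR (le_trans (ler_norm _))//; exact/ltW/archi_boundP.
Qed.

Lemma supremum_real (K : scalarFieldType) (A : set K) : (forall x, A x -> x \is Num.real) ->
  A !=set0 -> ubound A !=set0 -> supremums A (supremum 0 A).
Proof.
move=> rA A0 uA; rewrite /supremum ifF; last by apply/negbTE/set0P.
by have [s As] := real_supremums real_or_complexP rA A0 uA; case: xgetP => // /(_ s).
Qed.

Section dual.
Variables (K : scalarFieldType) (Y : normedModType K).

Definition dual_pred : {pred Y -> K^o} :=
  mem [set f : Y -> K^o | linear f /\ continuous f].

Record dual := Dual { dual_fun :> Y -> K^o; dual_funP : dual_fun \in dual_pred }.

HB.instance Definition _ := [isSub for dual_fun].
HB.instance Definition _ := [Choice of dual by <:].

Fact dual_pred_submod : submod_closed dual_pred.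
Proof.
split=> [|a f g]; first by apply/mem_set; split=> [a x y|]; [rewrite scaler0 addr0|exact: cst_continuous].
move=> /set_mem[lf cf] /set_mem[lg cg]; apply/mem_set; split=> [b x y|x].
  rewrite -[LHS]/(a *: f (b *: x + y) + g (b *: x + y)).
  rewrite -[RHS]/(b *: (a *: f x + g x) + (a *: f y + g y)).
  by rewrite lf lg !scalerDr !scalerA addrACA (mulrC a).
by apply: continuousD; [apply: continuousZl_tmp; exact: cf|exact: cg].
Qed.

HB.instance Definition _ :=
  GRing.isSubmodClosed.Build K (Y -> K^o) dual_pred dual_pred_submod.
HB.instance Definition _ := [SubChoice_isSubLmodule of dual by <:].

Lemma dual_linear (f : dual) : linear f.
Proof. by have /set_mem[] := dual_funP f. Qed.

HB.instance Definition _ (f : dual) := GRing.isLinear.Build K Y K^o *:%R f (dual_linear f).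

Lemma dual_continuous (f : dual) : continuous f.
Proof. by have /set_mem[] := dual_funP f. Qed.

(* [supremum] is taken in the partially ordered field [K]; the set consists of
   real elements, see [dual_norm_supremums]. *)
Definition dual_norm (f : dual) : K :=
  supremum 0 [set `|f y| | y in [set y | `|y| <= 1]].

Lemma dual_bounded (f : dual) : exists2 M, 0 <= M & forall y, `|f y| <= M * `|y|.
Proof.
have /linear_bounded_continuous/linear_boundedP := @dual_continuous f.
by move=> /pinfty_ex_gt0[M M0 fM]; exists M => //; exact: ltW.
Qed.

Lemma dual_norm_supremums (f : dual) :
  supremums [set `|f y| | y in [set y | `|y| <= 1]] (dual_norm f).
Proof.
apply: supremum_real => [_ [y _ <-]//||].
  by exists `|f 0|, 0; rewrite //= normr0.
have [M M0 fM] := dual_bounded f; exists M => _ [y /= y1 <-].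
by rewrite (le_trans (fM y))// ler_piMr.
Qed.

Lemma dual_norm_ge (f : dual) y : `|f y| <= dual_norm f * `|y|.
Proof.
have [->|y0] := eqVneq y 0; first by rewrite linear0 !normr0 mulr0.
have [+ _] := dual_norm_supremums f => /(_ `|f (`|y|^-1 *: y)|).
rewrite linearZ normrZ normfV normr_id ler_pdivrMl ?normr_gt0// (mulrC `|y|); apply.
by exists (`|y|^-1 *: y); rewrite /= ?normfZV// linearZ normrZ normfV normr_id.
Qed.

Lemma dual_norm_le (f : dual) M : 0 <= M ->
  (forall y, `|f y| <= M * `|y|) -> dual_norm f <= M.
Proof.
move=> M0 fM; have [_] := dual_norm_supremums f; apply => _ [y /= y1 <-].
by rewrite (le_trans (fM y))// ler_piMr.
Qed.

Lemma dual_norm_ge0 (f : dual) : 0 <= dual_norm f.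
Proof.
have [+ _] := dual_norm_supremums f => /(_ `|f 0|); rewrite linear0 normr0; apply.
by exists 0; rewrite /= ?linear0 normr0.
Qed.

Lemma dual_normD (f g : dual) : dual_norm (f + g) <= dual_norm f + dual_norm g.
Proof.
apply: dual_norm_le => [|y]; first by rewrite addr_ge0 ?dual_norm_ge0.
by rewrite mulrDl (le_trans (ler_normD _ _))// lerD ?dual_norm_ge.
Qed.

Lemma dual_normZ (a : K) (f : dual) : dual_norm (a *: f) = `|a| * dual_norm f.
Proof.
have le b g : dual_norm (b *: g) <= `|b| * dual_norm g.
  apply: dual_norm_le => [|y]; first by rewrite mulr_ge0 ?dual_norm_ge0.
  by rewrite [leLHS]normrM -mulrA ler_wpM2l ?dual_norm_ge.
apply/eqP; rewrite eq_le le /=.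
have [->|a0] := eqVneq a 0; first by rewrite normr0 mul0r dual_norm_ge0.
by rewrite -ler_pdivlMl ?normr_gt0// -normfV -[in leLHS](scalerK a0 f) le.
Qed.

Lemma dual_norm0_eq0 (f : dual) : dual_norm f = 0 -> f = 0.
Proof.
move=> f0; apply/val_inj/funext => y; apply/eqP.
by rewrite /= -normr_le0 (le_trans (dual_norm_ge f y))// f0 mul0r.
Qed.

HB.instance Definition _ := Lmodule_isNormed.Build K dual dual_normD dual_normZ dual_norm0_eq0.

Lemma dual_normE (f : dual) : `|f| = supremum 0 [set `|f y| | y in [set y | `|y| <= 1]].
Proof. by []. Qed.

End dual.
Section hahn_banach.
Variables (K : scalarFieldType) (X : normedModType K).
Implicit Types (G : set (X * K)) (x y : X) (r s t : K).

Let KP := @real_or_complexP K.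

Let dominated G := [/\ forall x r, G (x, r) -> r \is Num.real /\ r <= `|x|,
  forall x y r s, G (x, r) -> G (y, s) -> G (x + y, r + s) &
  forall x r t, t \is Num.real -> G (x, r) -> G (t *: x, t * r)].

Let dominated_extend G x1 : dominated G -> G !=set0 -> exists c,
  let G' := [set p | exists x r t,
    [/\ G (x, r), t \is Num.real & p = (x + t *: x1, r + t * c)]] in
  dominated G'.
Proof.
move=> [Gr GD GZ] [[a ra] Ga].
have Gp x r y s : G (x, r) -> G (y, s) -> r - `|x - x1| <= `|y + x1| - s.
  move=> Gx Gy; rewrite lerBlDr addrAC lerBrDr.
  have [_ /le_trans ->//] := Gr _ _ (GD _ _ _ _ Gx Gy).
  by rewrite (le_trans _ (ler_normD _ _))// addrAC addrA subrK addrC.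
pose S := [set q.2 - `|q.1 - x1| | q in G].
have [|||c [cU cL]] := @real_supremums K S KP _ _ _.
- by move=> _ [[x r] /= Gx <-]; rewrite rpredB ?normr_real//; have [] := Gr _ _ Gx.
- by exists (ra - `|a - x1|), (a, ra).
- by exists (`|a + x1| - ra) => _ [[x r] /= Gx <-]; exact: Gp.
have cr : c \is Num.real.
  rewrite -[c](subrK (ra - `|a - x1|)) rpredD//.
    by rewrite ger0_real// subr_ge0; apply: cU; exists (a, ra).
  by rewrite rpredB ?normr_real//; have [] := Gr _ _ Ga.
have c1 x r : G (x, r) -> r - c <= `|x - x1|.
  by move=> Gx; rewrite lerBlDr -lerBlDl; apply: cU; exists (x, r).
have c2 x r : G (x, r) -> r + c <= `|x + x1|.
  move=> Gx; rewrite -lerBrDl; apply: cL => _ [[y s] /= Gy <-]; exact: Gp.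
exists c => /=; split.
- move=> _ _ [x [r [t [Gx tr [-> ->]]]]].
  have [rr rx] := Gr _ _ Gx; split; first by rewrite rpredD ?rpredM.
  have [t0|t0|->] := real_ltgtP tr (@real0 K); last by rewrite mul0r scale0r !addr0.
  + have nt0 : 0 < - t by rewrite oppr_gt0.
    have := c1 _ _ (GZ _ _ (- t)^-1 _ Gx); rewrite realV realN => /(_ tr).
    rewrite -(ler_pM2l nt0) mulrBr mulVKf ?gt_eqF// mulNr opprK => /le_trans; apply.
    rewrite -[X in X * _]gtr0_norm// -normrZ scalerBr scalerA divff ?gt_eqF// scale1r.
    by rewrite scaleNr opprK.
  + have := c2 _ _ (GZ _ _ t^-1 _ Gx); rewrite realV => /(_ tr).
    rewrite -(ler_pM2l t0) mulrDr mulVKf ?gt_eqF// => /le_trans; apply.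
    rewrite -[X in X * _]gtr0_norm// -normrZ scalerDr scalerA divff ?gt_eqF//.
    by rewrite scale1r.
- move=> _ _ _ _ [x [r [t [Gx tr [-> ->]]]]] [y [s [t' [Gy t'r [-> ->]]]]].
  exists (x + y), (r + s), (t + t'); rewrite rpredD// scalerDl mulrDl.
  by split; [exact: GD|by []|rewrite addrACA [in X in (_, X)]addrACA].
- move=> _ _ t' t'r [x [r [t [Gx tr [-> ->]]]]].
  exists (t' *: x), (t' * r), (t' * t).
  by rewrite rpredM// scalerDr mulrDr scalerA mulrA; split=> //; exact: GZ.
Qed.

Let real_hahn_banach x0 : exists u : X -> K,
  [/\ forall x, u x \is Num.real /\ u x <= `|x|,
      forall x y, u (x + y) = u x + u y,
      forall x t, t \is Num.real -> u (t *: x) = t * u x & u x0 = `|x0|].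
Proof.
pose P := [set G | dominated G /\ (G !=set0 -> G (x0, `|x0|))].
have [F FP Ftot|G [[Gdom G0] Gmax]] := @Zorn_bigcup _ P.
  split; last by move=> [z [A FA Az]]; exists A => //; apply: (FP _ FA).2; exists z.
  split=> [x r [A FA Axr]|x y r s [A FA Ax] [B FB Bx]|x r t tr [A FA Ax]].
  - by have [[+ _ _] _] := FP _ FA; apply.
  - have [AB|BA] := Ftot _ _ FA FB.
      by exists B => //; have [[_ + _] _] := FP _ FB; apply=> //; exact: AB.
    by exists A => //; have [[_ + _] _] := FP _ FA; apply=> //; exact: BA.
  - by exists A => //; have [[_ _ +] _] := FP _ FA; apply.
have {}G0 : G (x0, `|x0|).
  apply: G0; apply: contrapT => /nonemptyPn G0.
  pose L := [set p | exists2 t, t \is Num.real & p = (t *: x0, t * `|x0|)].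
  have Lx0 : L (x0, `|x0|) by exists 1; rewrite ?real1// scale1r mul1r.
  apply: (Gmax L); first by rewrite G0; split=> // /(_ _ Lx0).
  split=> //; split.
  - move=> _ _ [t tr [-> ->]]; split; first by rewrite rpredM ?normr_real.
    by rewrite normrZ ler_wpM2r// real_ler_norm.
  - move=> _ _ _ _ [t tr [-> ->]] [s sr [-> ->]].
    by exists (t + s); rewrite ?rpredD// scalerDl mulrDl.
  - move=> _ _ s sr [t tr [-> ->]].
    by exists (s * t); rewrite ?rpredM// scalerA mulrA.
have Gtot x : exists r, G (x, r).
  apply: contrapT => nGx.
  have [|c /= domG'] := @dominated_extend G x Gdom; first by exists (x0, `|x0|).
  set G' := (X in dominated X) in domG'.
  have GG' : G `<=` G'.
    by move=> [y r] Gy; exists y, r, 0; rewrite real0 scale0r mul0r !addr0.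
  apply: (Gmax G'); last by split=> // _; exact: GG'.
  split=> // /(_ (x, c)) G'G; apply: nGx; exists c; apply: G'G.
  exists 0, 0, 1; rewrite real1 scale1r mul1r !add0r; split=> //.
  by have [_ _ /(_ _ _ 0 (@real0 K) G0)] := Gdom; rewrite scale0r mul0r.
have [Gr GD GZ] := Gdom.
have Gfun x r s : G (x, r) -> G (x, s) -> r = s.
  suff le r' s' : G (x, r') -> G (x, s') -> r' <= s'.
    by move=> Gxr Gxs; apply/eqP; rewrite eq_le !le.
  move=> Gxr /(GZ _ _ (-1)); rewrite realN real1 => /(_ isT) /(GD _ _ _ _ Gxr).
  by rewrite scaleN1r mulN1r subrr => /Gr[_]; rewrite normr0 subr_le0.
have [u Gu] := choice Gtot.
exists u; split=> [x|x y|x t tr|]; first exact: Gr.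
- by apply: Gfun (Gu _) _; exact: GD.
- by apply: Gfun (Gu _) _; exact: GZ.
- exact: Gfun (Gu _) G0.
Qed.

Lemma hahn_banach x0 : exists f : dual X,
  (forall x, `|f x| <= `|x|) /\ f x0 = `|x0|.
Proof.
have [u [u_le uD uZ ux0]] := real_hahn_banach x0.
have [i [re [im [reimE rereal _ _ [le_re icase]]]]] := cartesian KP.
have uN x : u (- x) = - u x by rewrite -scaleN1r uZ ?realN ?real1// mulN1r.
pose f x : K := u x - i * u (i *: x).
have fD x y : f (x + y) = f x + f y.
  by rewrite /f scalerDr !uD mulrDr opprD addrACA.
have fR t x : t \is Num.real -> f (t *: x) = t * f x.
  by move=> tr; rewrite /f scalerA (mulrC i t) -scalerA (uZ x)// (uZ (i *: x))// mulrBr (mulrCA i).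
have fi x : f (i *: x) = i * f x.
  rewrite /f; case: icase => [[-> _]|ii]; first by rewrite !mul0r scale0r -[0 in LHS](scale0r (0 : X)) uZ ?real0// mul0r subr0.
  by rewrite scalerA ii scaleN1r uN mulrBr mulrA ii mulN1r mulrN !opprK addrC.
have fZ a x : f (a *: x) = a * f x.
  have /andP[rr ri] := rereal a.
  rewrite [in LHS](reimE a) scalerDl fD -scalerA fi !fR//.
  by rewrite [in RHS](reimE a) mulrDl mulrA.
have lf : linear (f : X -> K^o) by move=> a x y; rewrite fD fZ.
have f_le x : `|f x| <= `|x|.
  have [->|fx0] := eqVneq (f x) 0; first by rewrite normr0.
  pose c := `|f x| / f x.
  have c1 : `|c| = 1 by rewrite normrM normfV normr_id divff ?normr_eq0.
  have fcx : f (c *: x) = `|f x| by rewrite fZ mulfVK.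
  have fr y : f y \is Num.real -> f y = u y.
    rewrite /f; case: icase => [[-> _]|ii]; first by rewrite mul0r subr0.
    move=> fyr; have [uyr _] := u_le y.
    have [viy _] := u_le (i *: y).
    have iu_real : i * u (i *: y) \is Num.real.
      by rewrite -(subKr (u y) (i * _)) rpredB.
    have := real_exprn_even_ge0 (n:=2) iu_real isT.
    rewrite exprMn expr2 ii mulN1r oppr_ge0 => h.
    have : u (i *: y) ^+ 2 == 0 by rewrite eq_le h real_exprn_even_ge0.
    by rewrite expf_eq0 /= => /eqP ->; rewrite mulr0 subr0.
  rewrite -fcx fr; last by rewrite fcx normr_real.
  by have [_ /le_trans ->//] := u_le (c *: x); rewrite normrZ c1 mul1r.
have cf : continuous (f : X -> K^o).
  pose lfM := GRing.isLinear.Build K X K^o *:%R (f : X -> K^o) lf.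
  pose fl : {linear X -> K^o} := HB.pack (f : X -> K^o) lfM.
  apply: (@bounded_linear_continuous K X K^o fl); apply/linear_boundedP.
  exists 1; split=> // M M1 x; rewrite (le_trans (f_le x))//.
  by rewrite ler_peMl// ltW.
pose g := Dual (mem_set (conj lf cf)).
have gx0 : `|f x0| = `|x0|.
  apply/eqP; rewrite eq_le f_le /= -[leLHS]normr_id -ux0 /f -mulrN.
  by apply: le_re; rewrite ?realN; exact: (proj1 (u_le _)).
have [x00|x00] := eqVneq x0 0.
  by exists g; split=> //; rewrite x00 normr0 (linear0 g).
have fx00 : f x0 != 0 by rewrite -normr_eq0 gx0 normr_eq0.
exists ((`|x0| / f x0) *: g); split=> [x|]; last exact: divfK.
by rewrite [leLHS]normrM normrM normfV gx0 normr_id divff ?normr_eq0// mul1r f_le.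
Qed.
End hahn_banach.

Section uniform_boundedness.
Variable K : scalarFieldType.
Implicit Types (u v e : nat -> K) (z : K).

Let KP := @real_or_complexP K.

Let real_nested v e : (forall n, v n \is Num.real) ->
  (forall n m, (n <= m)%N -> `|v m - v n| <= e n) ->
  exists l, forall n, `|l - v n| <= e n.
Proof.
move=> vr ve.
have e0 n : 0 <= e n by rewrite (le_trans _ (ve n n (leqnn _))).
have er n : e n \is Num.real by exact: ger0_real.
have vv n m : v n - e n <= v m + e m.
  have [nm|/ltnW mn] := leqP n m; last first.
    have := ve _ _ mn; rewrite real_ler_distl ?rpredB// => /andP[_ h].
    by rewrite (le_trans _ h)// gerDl oppr_le0.
  have := ve _ _ nm; rewrite real_ler_distl ?rpredB// => /andP[h _].
  by rewrite (le_trans h)// lerDl.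
have [|||l [lU lL]] := @real_supremums K [set v n - e n | n in [set: nat]] KP.
- by move=> _ [n _ <-]; rewrite rpredB.
- by exists (v 0 - e 0), 0.
- by exists (v 0 + e 0) => _ [n _ <-]; exact: vv.
have lv n : v n - e n <= l by apply: lU; exists n.
exists l => n; have lr : l \is Num.real.
  by rewrite -[l](subrK (v n - e n)) rpredD ?(rpredB _ (er n))// ger0_real// subr_ge0.
rewrite real_ler_distl ?rpredB// lv /=; apply: lL => _ [m _ <-]; exact: vv.
Qed.

Lemma scalar_nested u e :
  (forall n m, (n <= m)%N -> `|u m - u n| <= e n) ->
  exists l, forall n, `|l - u n| <= 2 * e n.
Proof.
move=> ue; have [i [re [im [reimE rereal le_reim reimB [_ icase]]]]] := cartesian KP.
have [||lr lrP] := @real_nested (re \o u) e.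
- by move=> n; have /andP[] := rereal (u n).
- move=> n m nm /=; rewrite -(reimB _ _).1; apply: le_trans (ue _ _ nm).
  by have /andP[] := le_reim (u m - u n).
have [||li liP] := @real_nested (im \o u) e.
- by move=> n; have /andP[] := rereal (u n).
- move=> n m nm /=; rewrite -(reimB _ _).2; apply: le_trans (ue _ _ nm).
  by have /andP[] := le_reim (u m - u n).
have i1 : `|i| <= 1.
  case: icase => [[-> _]|ii]; first by rewrite normr0.
  by rewrite -(@expr_le1 _ 2)// -normrX expr2 ii normrN normr1.
exists (lr + i * li) => n; rewrite [X in _ - X]reimE opprD addrACA -mulrBr.
rewrite mulr2n mulrDl mul1r (le_trans (ler_normD _ _))// lerD ?lrP//.
by rewrite normrM (le_trans _ (liP n))// ler_piMl.
Qed.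

Let q : K := 16^-1.
Let q0 : 0 < q. Proof. by rewrite invr_gt0 ltr0n. Qed.
Let qn0 n : 0 < q ^+ n. Proof. exact: exprn_gt0. Qed.

Lemma geometric_le0 z C : 0 <= z -> (forall n, z <= C * q ^+ n) -> z = 0.
Proof.
move=> z0 zC; apply/eqP/negPn/negP => zn0.
have {zn0}z0 : 0 < z by rewrite lt_neqAle eq_sym zn0.
have [N CN] := scalar_arch (C / z) KP.
have C0 : 0 < C by have := lt_le_trans z0 (zC 0); rewrite expr0 mulr1.
move: CN; rewrite gtr0_norm ?divr_gt0// ler_pdivrMr// => CN.
have := zC N; rewrite /q exprVn ler_pdivlMr ?exprn_gt0// => /le_trans/(_ CN).
by rewrite mulrC ler_pM2r// -natrX ler_nat leqNgt ltn_expl.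
Qed.

Lemma uniform_boundedness (X : normedModType K) (T : Type) (f : T -> X) :
  (forall g : dual X, exists M, forall w, `|g (f w)| <= M) ->
  exists M, forall w, `|f w| <= M.
Proof.
move=> fM; apply: contrapT => /forallNP nM.
have /choice[w wP] n : exists w, n%:R < q ^+ n * `|f w|.
  have /existsNP[w fw] := nM (n%:R / q ^+ n); exists w.
  rewrite mulrC -ltr_pdivrMr// real_ltNge ?normr_real//; first exact/negP.
  by rewrite ger0_real// divr_ge0 ?ler0n// ltW.
pose y n := f (w n).
have half : 2^-1 + 2^-1 = 1 :> K by field.
have /choice[h hP] n := hahn_banach (y n).
pose S := fix S n : dual X := if n is m.+1 then
  if 2^-1 * (q ^+ m * `|y m|) <= `|S m (y m)| then S m else S m + q ^+ m *: h m
  else 0.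
have Sy n : 2^-1 * (q ^+ n * `|y n|) <= `|S n.+1 (y n)|.
  rewrite /=; case: ifPn => // /negP.
  move=> /negP; rewrite -real_ltNge ?normr_real//; last first.
    by rewrite ger0_real// !mulr_ge0 ?invr_ge0 ?ler0n// ltW.
  move=> /ltW Sn; rewrite -[dual_fun (_ + _) _]/(S n (y n) + q ^+ n * h n (y n)) (hP n).2.
  rewrite addrC (le_trans _ (lerB_normD _ _))// lerBrDr.
  rewrite normrM normr_id (gtr0_norm (qn0 n)).
  by rewrite (le_trans (lerD (lexx _) Sn))// -mulrDl half mul1r.
have SS n m x : (n <= m)%N -> `|S m x - S n x| <= 2 * (q ^+ n - q ^+ m) * `|x|.
  move=> /subnK <-; elim: (m - n)%N => [|k IH].
    by rewrite add0n !subrr normr0 mulr0 mul0r.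
  rewrite addSn; set j := (k + n)%N in IH *.
  have Sj : `|S j.+1 x - S j x| <= q ^+ j * `|x|.
    rewrite /=; case: ifP => _; first by rewrite subrr normr0 mulr_ge0// ltW.
    rewrite -[dual_fun (_ + _) _]/(S j x + q ^+ j * h j x) addrC addKr normrM.
    by rewrite (gtr0_norm (qn0 j)) ler_wpM2l ?(hP j).1// ltW.
  rewrite -(subrK (S j x) (S j.+1 x)) -addrA (le_trans (ler_normD _ _))//.
  rewrite (le_trans (lerD Sj IH))// -mulrDl ler_wpM2r//.
  rewrite addrC -lerBrDl -mulrBr opprB addrC addrA subrK exprS.
  rewrite -[X in _ * (X - _)]mul1r -mulrBl mulrA ler_peMl// ?(ltW (qn0 _))//.
  rewrite mulrBr mulr1 lerBrDl -lerBrDr /q.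
  rewrite [leRHS](_ : _ = 1); last by rewrite -natr1 addrK.
  by rewrite ler_pdivrMr ?ltr0n// mul1r ler_nat.
have SS' x n m : (n <= m)%N -> `|S m x - S n x| <= 2 * q ^+ n * `|x|.
  move=> nm; rewrite (le_trans (SS _ _ _ nm))// ler_wpM2r// ler_wpM2l ?ler0n//.
  by rewrite gerBl ltW.
have /choice[l lP] x := scalar_nested (SS' x).
have lP' x n : `|l x - S n x| <= 4 * `|x| * q ^+ n.
  by rewrite (le_trans (lP x n))// !mulrA -natrM mulrAC.
have SD n a x x' : S n (a *: x + x') = a * S n x + S n x' by exact: dual_linear.
have lD a x x' : l (a *: x + x') = a * l x + l x'.
  apply/eqP; rewrite -subr_eq0 -normr_eq0; apply/eqP.
  apply: (@geometric_le0 _ (4 * `|a *: x + x'| + (`|a| * (4 * `|x|) + 4 * `|x'|))) => // n.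
  have -> : l (a *: x + x') - (a * l x + l x') =
      (l (a *: x + x') - S n (a *: x + x')) - (a * (l x - S n x) + (l x' - S n x')).
    by rewrite SD; ring.
  rewrite (le_trans (ler_normB _ _))// mulrDl lerD// (le_trans (ler_normD _ _))//.
  by rewrite mulrDl lerD// normrM -mulrA ler_wpM2l.
have lf : linear (l : X -> K^o) by move=> a x x'; exact: lD.
have l_le x : `|l x| <= 4 * `|x|.
  by have := lP' x 0%N; rewrite /= subr0 expr0 mulr1.
have cl : continuous (l : X -> K^o).
  pose llM := GRing.isLinear.Build K X K^o *:%R (l : X -> K^o) lf.
  pose ll : {linear X -> K^o} := HB.pack (l : X -> K^o) llM.
  apply: (@bounded_linear_continuous K X K^o ll); apply/linear_boundedP.
  exists 4; split=> // M M4 x; rewrite (le_trans (l_le x))//.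
  by rewrite ler_wpM2r// ltW.
have [M lM] := fM (Dual (mem_set (conj lf cl))).
have [N MN] := scalar_arch (4 * M) KP.
have : 4^-1 * (q ^+ N * `|y N|) <= `|l (y N)|.
  rewrite -[l _](subrK (S N.+1 (y N))) addrC.
  rewrite (le_trans _ (lerB_normD _ _))// lerBrDr (le_trans _ (Sy N))//.
  have /(lerD (lexx _))/le_trans := lP' (y N) N.+1; apply.
  rewrite exprS [X in _ + X](_ : _ = 4^-1 * (q ^+ N * `|y N|)) ?/q; last by field.
  by rewrite -mulrDl [X in X * _ <= _](_ : _ = 2^-1)//; field.
move=> /le_trans/(_ (lM (w N))); rewrite ler_pdivrMl ?ltr0n// => qM.
have M4 : 0 <= 4 * M by rewrite (le_trans _ qM)// mulr_ge0// ltW.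
move: MN; rewrite ger0_norm// => /(le_trans qM)/le_lt_trans/(_ (wP N)).
by rewrite ltxx.
Qed.
End uniform_boundedness.

HB.mixin Record Topological_isCompact T & Topological T := {
  compact_setT : compact [set: T]
}.

#[short(type="compactType")]
HB.structure Definition CompactSpace :=
  {T of Topological_isCompact T & Topological T}.

Section weak_topologies.
Variables (K : scalarFieldType) (Y : normedModType K).

(* sigma(Y, Y^* ) *)
Definition weak_top : Type := initial_topology
  (fun y : Y => (fun g : dual Y => g y) : {ptws dual Y -> K^o}).
HB.instance Definition _ := Topological.on weak_top.

(* sigma(Y^*, Y) *)
Definition weakstar_top : Type := initial_topology
  (fun g : dual Y => (g : Y -> K^o) : {ptws Y -> K^o}).
HB.instance Definition _ := Topological.on weakstar_top.

Definition dual_ball : set (dual Y) := [set g | `|g| <= 1].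

Let initial_ptws_cvgP (S : choiceType) (Z : topologicalType)
    (ev : S -> {ptws Z -> K^o}) (F : set_system (initial_topology ev))
    (s : initial_topology ev) : Filter F ->
  F --> s <-> forall z, ev ^~ z @ F --> ev s z.
Proof.
move=> FF; split=> [Fs|Fs].
  suff : {ptws, ev @ F --> ev s} by move=> /pointwise_cvgP.
  exact: (cvg_comp _ _ Fs (@initial_continuous S {ptws Z -> K^o} ev s)).
have {}Fs : {ptws, ev @ F --> ev s} by apply/pointwise_cvgP.
move=> U [_ [[W oW <-] Ws]] /filterS; apply; apply: Fs.
exact: open_nbhs_nbhs.
Qed.

Lemma weak_cvgP (F : set_system weak_top) (y : weak_top) : Filter F ->
  F --> y <-> forall g : dual Y, (g : Y -> K^o) @ F --> (g y : K^o).
Proof. exact: initial_ptws_cvgP. Qed.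

Lemma weakstar_cvgP (F : set_system weakstar_top) (g : weakstar_top) : Filter F ->
  F --> g <-> forall y, (fun h : dual Y => h y : K^o) @ F --> ((g : dual Y) y : K^o).
Proof. exact: initial_ptws_cvgP. Qed.

End weak_topologies.

(* Weak-star to weak continuity at [g] of the identity map of the closed unit
   ball of [dual Y]; the target topology is sigma(Y^*, Y^** ). *)
Definition weakstar_weak_PC (K : scalarFieldType) (Y : normedModType K)
    (g : dual Y) :=
  dual_ball g /\
  (id : weakstar_top Y -> weak_top (dual Y))
    @ within (@dual_ball K Y) (nbhs (g : weakstar_top Y))
    --> (g : weak_top (dual Y)).

Section WC.
Variables (K : scalarFieldType) (O : compactType) (X : normedModType K).

Lemma weak_continuousP (f : O -> X) :
  continuous (f : O -> weak_top X) <->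
  forall g : dual X, continuous (g \o f : O -> K^o).
Proof.
split=> [cf g x|cf x]; first exact: (iffLR (@weak_cvgP K X _ _ _) (cf x)).
by apply/weak_cvgP => g; exact: cf.
Qed.

Definition WC_pred : {pred O -> X} := mem [set f | continuous (f : O -> weak_top X)].

Record WC := MkWC { WC_fun :> O -> X; WC_funP : WC_fun \in WC_pred }.

HB.instance Definition _ := [isSub for WC_fun].
HB.instance Definition _ := [Choice of WC by <:].

Fact WC_pred_submod : submod_closed WC_pred.
Proof.
split=> [|a f g]; first by apply/mem_set => x; exact: cst_continuous.
move=> /set_mem/weak_continuousP cf /set_mem/weak_continuousP cg.
apply/mem_set/weak_continuousP => h x.
have -> : h \o (a *: f + g) = (fun x => a *: (h (f x) : K^o) + h (g x)).
  by apply/funext => z; exact: dual_linear.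
apply: (@continuousD K K^o _ (fun x => a *: (h (f x) : K^o)) (h \o g)); last exact: cg.
by apply: continuousZl_tmp; exact: cf.
Qed.

HB.instance Definition _ :=
  GRing.isSubmodClosed.Build K (O -> X) WC_pred WC_pred_submod.
HB.instance Definition _ := [SubChoice_isSubLmodule of WC by <:].

Lemma WC_continuous (f : WC) : continuous (f : O -> weak_top X).
Proof. by have /set_mem := WC_funP f. Qed.

Lemma compact_norm_bounded (h : O -> K^o) : continuous h ->
  exists2 M, 0 <= M & forall w, `|h w| <= M.
Proof.
move=> ch; have /compact_near_coveringP := @compact_setT O.
move=> /(_ K +oo (fun M w => `|h w| <= M) _).
case=> [|M [Mr hM]]; last first.
  exists (`|M| + 1) => [|w]; first by rewrite addr_ge0.
  by apply: hM => //; rewrite (le_lt_trans (real_ler_norm Mr))// ltrDl.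
move=> w _; have hw : \forall w' \near w, `|h w'| <= `|h w| + 1.
  have /cvgrPdist_le/(_ 1 ltr01) := ch w; apply: filterS => w' hw'.
  by rewrite -(subrK (h w) (h w')) addrC (le_trans (ler_normD _ _))// lerD2l distrC.
have Mw : \forall M \near +oo, `|h w| + 1 <= M.
  by apply: nbhs_pinfty_ge; rewrite ger0_real// addr_ge0.
near=> w' M => /=; apply: (@le_trans _ _ (`|h w| + 1)); first by near: w'.
by near: M.
Unshelve. all: by end_near. Qed.

Lemma WC_bounded (f : WC) : exists M, forall w, `|f w| <= M.
Proof.
apply: uniform_boundedness => g.
have /weak_continuousP/(_ g)/compact_norm_bounded[M _ gM] := @WC_continuous f.
by exists M.
Qed.

(* A weakly continuous function on a compact space is norm bounded
   ([WC_bounded]), so that the supremum below exists. *)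
Definition WC_norm (f : WC) : K := supremum 0 [set `|f w| | w in [set: O]].

Lemma WC_norm_ge (f : WC) w : `|f w| <= WC_norm f.
Proof.
have [||| + _] := @supremum_real K [set `|f w| | w in [set: O]].
- by move=> _ [? _ <-].
- by exists `|f w|, w.
- by have [M fM] := WC_bounded f; exists M => _ [? _ <-].
- by apply; exists w.
Qed.

Lemma WC_norm_le (f : WC) M : 0 <= M -> (forall w, `|f w| <= M) -> WC_norm f <= M.
Proof.
move=> M0 fM; have [[w _]|/nonemptyPn O0] := pselect ([set: O] !=set0); last first.
  by rewrite /WC_norm O0 image_set0 supremum0.
have [||| _] := @supremum_real K [set `|f w| | w in [set: O]].
- by move=> _ [? _ <-].
- by exists `|f w|, w.
- by exists M => _ [? _ <-].
- by apply => _ [? _ <-].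
Qed.

Lemma WC_norm_ge0 (f : WC) : 0 <= WC_norm f.
Proof.
have [[w _]|/nonemptyPn O0] := pselect ([set: O] !=set0).
  exact: le_trans (WC_norm_ge f w).
by rewrite /WC_norm O0 image_set0 supremum0.
Qed.

Lemma WC_normD (f g : WC) : WC_norm (f + g) <= WC_norm f + WC_norm g.
Proof.
apply: WC_norm_le => [|w]; first by rewrite addr_ge0 ?WC_norm_ge0.
by rewrite (le_trans (ler_normD _ _))// lerD ?WC_norm_ge.
Qed.

Lemma WC_normZ (a : K) (f : WC) : WC_norm (a *: f) = `|a| * WC_norm f.
Proof.
have le b g : WC_norm (b *: g) <= `|b| * WC_norm g.
  apply: WC_norm_le => [|w]; first by rewrite mulr_ge0 ?WC_norm_ge0.
  by rewrite [leLHS]normrZ ler_wpM2l ?WC_norm_ge.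
apply/eqP; rewrite eq_le le /=.
have [->|a0] := eqVneq a 0; first by rewrite normr0 mul0r WC_norm_ge0.
by rewrite -ler_pdivlMl ?normr_gt0// -normfV -[in leLHS](scalerK a0 f) le.
Qed.

Lemma WC_norm0_eq0 (f : WC) : WC_norm f = 0 -> f = 0.
Proof.
move=> f0; apply/val_inj/funext => w; apply/eqP.
by rewrite /= -normr_le0 -f0 WC_norm_ge.
Qed.

HB.instance Definition _ :=
  Lmodule_isNormed.Build K WC WC_normD WC_normZ WC_norm0_eq0.

Lemma WC_normE (f : WC) : `|f| = supremum 0 [set `|f w| | w in [set: O]].
Proof. by []. Qed.

Section tensor.
Variables (w : O) (g : dual X).

Definition delta_tensor_fun : WC -> K^o := fun f => g (f w).

Fact delta_tensor_subproof : delta_tensor_fun \in @dual_pred K WC.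
Proof.
have ld : linear delta_tensor_fun by move=> a f h; exact: dual_linear.
apply/mem_set; split=> //.
pose ldM := GRing.isLinear.Build K WC K^o *:%R delta_tensor_fun ld.
pose ldL : {linear WC -> K^o} := HB.pack delta_tensor_fun ldM.
apply: (@bounded_linear_continuous K WC K^o ldL); apply/linear_boundedP.
exists `|g|; split=> // M gM f; rewrite (le_trans (dual_norm_ge g (f w)))//.
by rewrite ler_pM// ?dual_norm_ge0// ?WC_norm_ge// ltW.
Qed.

Definition delta_tensor : dual WC := Dual delta_tensor_subproof.
End tensor.

End WC.

(* Main.v *)
Require Import Defs.
From HB Require Import structures.
From mathcomp Require Import all_boot all_order all_algebra.
From mathcomp Require Import boolp classical_sets functions cardinality filter.
From mathcomp Require Import reals topology normedtype sequences.
From mathcomp Require Import complex ring.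

(** Why the theorem holds. Write [Y] for [WC Omega X] and let [Lambda] be a point
    of continuity of the dual ball of [Y].

    The heart of the matter is that [Lambda] is almost carried by finitely many
    isolated points: for every [e > 0] there is a finite set [G] of isolated
    points with [|Lambda f| <= e] for all [f] in the ball of [Y] vanishing on [G]
    ([PC_small_off_isolated]). If [D] is dense in [Omega], the functionals
    [delta_tensor w g] with [w] in [D] and [|g| <= 1] norm [Y], so that every
    convex part of the dual ball containing them is weak-star dense in the ball
    ([bipolar]). If an element of the bidual kills these functionals, those that
    it kills form such a convex part, and continuity at [Lambda] shows that it
    kills [Lambda] as well. An ultralimit of functions [f_G], each vanishing on
    the finite subset [G] of [D], is such an element, so [Lambda f_G] cannot
    stay away from [0] ([PC_small_off_dense]). This is used twice, for all of
    [Omega] and for the complement of a finite set of non-isolated points; a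
    Urysohn function glues the two estimates together.

    Next, [|Lambda| = 1] ([PC_norm1]): otherwise every point of the dual ball
    would be a point of continuity, but evaluation at a non-isolated point, which
    exists as [Omega] is infinite and compact, is not small off any finite set of
    isolated points.

    At an isolated point [w] the space [Y] splits as a sup-norm direct sum
    carried by [w] and its complement, so that the dual is an l1-sum: [Lambda] has
    an atom [x |-> Lambda (spike w x)] there, and norms add up
    ([atom_norm_split]). Since a perturbation of the atom alone that does not
    increase its norm stays in the dual ball, the normalised atom is a point of
    continuity of the dual ball of [X] ([atom_PC]).

    Finally the sum over the atoms, which may be finitely many, is written as an
    infinite series with positive coefficients. Run through the points carrying
    nonzero atoms, visiting each infinitely often, and remove at each visit half
    of the atom that is left. The norms removed telescope to [|Lambda| = 1] minus
    the norm of the residual, and the residual tends to [0] in norm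
    ([residual_norm], [residual_to0]). *)

Set Implicit Arguments.
Unset Strict Implicit.
Unset Printing Implicit Defensive.
Import Order.TTheory GRing.Theory Num.Theory.
Import numFieldNormedType.Exports.
Local Open Scope classical_set_scope.
Local Open Scope ring_scope.

(** * Limits along ultrafilters in the scalar field *)

(** The complex conjugation, uniformly in the two kinds of scalars. *)
Lemma scalar_conj (K : numFieldType) : real_or_complex K ->
  exists c : K -> K, [/\ forall z w, c (z + w) = c z + c w,
    forall z w, c (z * w) = c z * c w, forall z, z * c z = `|z| ^+ 2,
    forall z, z + c z \is Num.real
    & involutive c /\ forall z, z \is Num.real -> c z = z].
Proof.
case: K / => R.
  by exists id; split=> // z; rewrite ?num_real// real_normK ?num_real// expr2.
exists Num.conj; split=> [z w|z w|z|z|]; first exact: rmorphD.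
- exact: rmorphM.
- by rewrite normCK.
- have := Creal_Re z; rewrite ReE => h.
  by rewrite -[z + _](divfK (_ : 2 != 0 :> R[i])) ?pnatr_eq0// rpredM// realn.
- by split=> [z|z zr]; [exact: conjCK|exact: conj_Creal].
Qed.

Lemma scalar_phase (K : numFieldType) (z : K) : exists2 a : K, `|a| <= 1 & a * z = `|z|.
Proof.
(* For [z = 0] the division convention makes the witness [0]. *)
exists (`|z| / z); have [->|z0] := eqVneq z 0; rewrite ?normr0 ?mul0r ?normr0 ?divfK//.
by rewrite normrM normfV normr_id divff ?normr_eq0.
Qed.

(** The limit is the supremum of the lower bounds that hold on a set of the
    ultrafilter: for each level, the ultrafilter decides on which side the
    function lies. *)
Lemma real_ultralimit (K : numFieldType) (T : Type) (U : set_system T) (u : T -> K)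
    (M : K) : real_or_complex K -> UltraFilter U -> (forall t, u t \is Num.real) ->
  U [set t | `|u t| <= M] -> exists l : K, u @ U --> (l : K^o).
Proof.
move=> KP UU ur uM.
pose A := [set r : K | r \is Num.real /\ U [set t | r <= u t]].
have M0 : 0 <= M.
  by have [t /= ut] := filter_ex uM; exact: le_trans ut.
have Mr : M \is Num.real by exact: ger0_real.
have uMM : U [set t | - M <= u t <= M].
  by apply: filterS uM => t /=; rewrite real_ler_norml.
have [||| l [lU lL]] := @real_supremums K A KP.
- by move=> r [].
- exists (- M); split; first by rewrite realN.
  by apply: filterS uMM => t /= /andP[].
- exists M => r [rr Ur]; have [t /= [rt /andP[_]]] := filter_ex (filterI Ur uMM).
  exact: le_trans.
have MA : A (- M).
  split; first by rewrite realN.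
  by apply: filterS uMM => t /= /andP[].
have lr : l \is Num.real.
  by rewrite -[l](subrK (- M)) rpredD ?realN// ger0_real// subr_ge0; exact: lU.
exists l; apply/cvgrPdist_le => /= e e0.
have er : e \is Num.real by exact: gtr0_real.
have H1 : U [set t | l - e <= u t].
  have [//|Un] := in_ultra_setVsetC [set t | l - e <= u t] UU.
  exfalso; have : l <= l - e.
    apply: lL => r [rr Ur].
    have [t [/= nt rt]] := filter_ex (filterI Un Ur).
    apply: (le_trans rt); move/negP: nt.
    by rewrite -real_ltNge ?rpredB//; exact: ltW.
  by rewrite lerBrDr gerDl lt_geF.
have H2 : U [set t | u t <= l + e].
  have [//|Un] := in_ultra_setVsetC [set t | u t <= l + e] UU.
  exfalso; have : l + e <= l.
    apply: lU; split; first by rewrite rpredD.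
    by apply: filterS Un => t /= /negP; rewrite -real_ltNge ?rpredD//; exact: ltW.
  by rewrite gerDl lt_geF.
apply: filterS2 H1 H2 => t /= h1 h2.
by rewrite distrC real_ler_distl ?rpredB// h1 h2.
Qed.

(** Real and imaginary parts converge separately. *)
Lemma bounded_ultralimit (K : numFieldType) (T : Type) (U : set_system T) (u : T -> K)
    (M : K) : real_or_complex K -> UltraFilter U ->
  U [set t | `|u t| <= M] -> exists l : K, u @ U --> (l : K^o).
Proof.
move=> KP UU uM.
have [i [re [im [reimE rereal le_reim _ _]]]] := cartesian KP.
have [||a aP] := @real_ultralimit K T U (re \o u) M KP UU.
- by move=> t; have /andP[] := rereal (u t).
- by apply: filterS uM => t /=; apply: le_trans; have /andP[] := le_reim (u t).
have [||b bP] := @real_ultralimit K T U (im \o u) M KP UU.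
- by move=> t; have /andP[] := rereal (u t).
- by apply: filterS uM => t /=; apply: le_trans; have /andP[] := le_reim (u t).
exists (a + i * b).
have -> : u = (fun t => re (u t) + i * im (u t)) by apply/funext => t.
apply: (@cvgD K K^o); first exact: aP.
by apply: (@cvgZl_tmp K K^o).
Qed.

(** * Functionals of bounded norm *)

Lemma dual_le (K : scalarFieldType) (Y : normedModType K) (h : dual Y) y :
  `|h y| <= `|h| * `|y|.
Proof. exact: dual_norm_ge. Qed.

Lemma dualZ (K : scalarFieldType) (Y : normedModType K) (h : dual Y) (a : K) y :
  h (a *: y) = a * h y.
Proof. by rewrite linearZ. Qed.

Lemma dualD (K : scalarFieldType) (Y : normedModType K) (h : dual Y) x y :
  h (x + y) = h x + h y.
Proof. by rewrite linearD. Qed.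

Lemma dualB (K : scalarFieldType) (Y : normedModType K) (h : dual Y) x y :
  h (x - y) = h x - h y.
Proof. by rewrite linearB. Qed.

Lemma dual_ball_le (K : scalarFieldType) (Y : normedModType K) (h : dual Y) y :
  dual_ball h -> `|h y| <= `|y|.
Proof. by move=> h1; rewrite (le_trans (dual_le h y))// ler_piMl. Qed.

Lemma dual_norm_le_ball (K : scalarFieldType) (Y : normedModType K) (h : dual Y) (M : K) :
  (forall y, `|y| <= 1 -> `|h y| <= M) -> `|h| <= M.
Proof. by move=> hM; have [_] := dual_norm_supremums h; apply => _ [y /= y1 <-]; exact: hM. Qed.

Lemma bounded_dual_pred (K : scalarFieldType) (Y : normedModType K) (f : Y -> K) (M : K) :
  (forall a x y, f (a *: x + y) = a * f x + f y) -> (forall x, `|f x| <= M * `|x|) ->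
  (f : Y -> K^o) \in @dual_pred K Y.
Proof.
move=> fD fM; apply/mem_set.
have lf : linear (f : Y -> K^o) by move=> a x x'; exact: fD.
split=> //.
pose lfM := GRing.isLinear.Build K Y K^o *:%R (f : Y -> K^o) lf.
pose fl : {linear Y -> K^o} := HB.pack (f : Y -> K^o) lfM.
apply: (@bounded_linear_continuous K Y K^o fl); apply/linear_boundedP.
exists `|M|; split=> [|N MN x]; first exact: normr_real.
rewrite (le_trans (fM x))//.
case: (eqVneq x 0) => [->|x0]; first by rewrite normr0 !mulr0.
have M0 : 0 <= M.
  by have := le_trans (normr_ge0 _) (fM x); rewrite pmulr_lge0 ?normr_gt0.
by rewrite ler_wpM2r// -(ger0_norm M0) ltW.
Qed.

(** * Weak-star density of norming convex sets *)

(** A convex set of functionals that norms [Y] is weak-star dense in the unit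
    ball of the dual: this is the bipolar theorem, stated for the basic
    neighbourhoods. The proof is a descent in place of a separation argument.
    Let [q p] be the squared Euclidean distance between the values of [p] and of
    [g] on [s]. The derivative of [q] at [p] in the direction [r - p] is
    [- 2 Re ((r - p) F)]. As [|g F| <= |F|] and some [r] in [P] almost attains
    [|F|] at [F], moving from [p] a little towards [r] lowers [q] by a fixed
    amount as long as [1 <= q]. This cannot be repeated indefinitely. Radius [1]
    suffices for all neighbourhoods, because the vectors in [s] can be
    rescaled. *)
Lemma bipolar (K : scalarFieldType) (Y : normedModType K) (P : set (dual Y)) :
  P `<=` @dual_ball K Y ->
  (forall p r (t : K), 0 <= t <= 1 -> P p -> P r -> P (p + t *: (r - p))) ->
  (forall y (e : K), 0 < e -> exists2 p, P p & `|y| - e <= p y) ->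
  forall g, dual_ball g -> forall s : seq Y,
  exists2 p, P p & forall y, y \in s -> `|p y - g y| < 1.
Proof.
move=> Pball Pconv Pnorm g gball s.
have [c [cD cM cN cr [cK cR]]] := scalar_conj (@real_or_complexP K).
have cB z w : c (z - w) = c z - c w by rewrite cD -mulN1r cM (cR (-1)) ?realN ?real1// mulN1r.
have c0 : c 0 = 0 by rewrite cR ?real0.
have cnorm z : `|c z| = `|z|.
  have [->|z0] := eqVneq z 0; first by rewrite c0.
  apply: (@mulfI _ `|z|); first by rewrite normr_eq0.
  by rewrite -normrM cN normrX normr_id expr2.
pose q (p : dual Y) : K := \sum_(y <- s) `|g y - p y| ^+ 2.
have q0 p : 0 <= q p by apply: sumr_ge0 => y _; rewrite exprn_ge0.
have [[p [Pp qp]]|/forallNP nq] := pselect (exists p, P p /\ q p < 1).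
  exists p => // y ys.
  rewrite distrC -(@expr_lt1 _ 2)// (le_lt_trans _ qp)// /q (big_rem y)//= lerDl.
  by apply: sumr_ge0 => z _; rewrite exprn_ge0.
exfalso.
have {}nq p : P p -> 1 <= q p.
  move=> Pp; rewrite real_leNgt ?real1 ?ger0_real//.
  by apply/negP => qp; apply: (nq p).
(* [B] bounds the squared length of every displacement [r - p] in [P], so that
   the step [t] keeps the quadratic term below half of the linear gain. *)
pose B : K := \sum_(y <- s) (2 * `|y|) ^+ 2.
have B0 : 0 <= B by apply: sumr_ge0 => y _; rewrite exprn_ge0// mulr_ge0.
pose t : K := (2 * (B + 1))^-1.
have B1 : 0 < B + 1 by rewrite ltr_wpDl.
have t0 : 0 < t by rewrite invr_gt0 mulr_gt0.
have tr : t \is Num.real by exact: gtr0_real.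
have t1 : t <= 1.
  rewrite invf_le1 ?mulr_gt0// mulr_natl mulr2n ler_wpDr ?(ltW B1)//.
  by rewrite lerDr.
have tB : t * (t * B) <= t * 2^-1.
  rewrite ler_wpM2l ?(ltW t0)// /t invfM -mulrA ler_piMr ?invr_ge0//.
  by rewrite mulrC ler_pdivrMr// mul1r lerDl.
have step p : P p -> exists2 p', P p' & q p' <= q p - t * 2^-1.
  move=> Pp; pose F : Y := \sum_(y <- s) c (g y - p y) *: y.
  have hF (h : dual Y) : h F = \sum_(y <- s) c (g y - p y) * h y.
    by rewrite linear_sum; apply: eq_bigr => y _; rewrite linearZ.
  have h0 : 0 < 2^-1 :> K by rewrite invr_gt0.
  have [r Pr rF] := Pnorm F 2^-1 h0.
  exists (p + t *: (r - p)); first by apply: Pconv => //; rewrite ltW.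
  have rr : r F \is Num.real.
    rewrite -[r F](subrK (`|F| - 2^-1)) rpredD//; first by rewrite ger0_real// subr_ge0.
    by rewrite rpredB// ?normr_real// ger0_real// invr_ge0.
  have qE : q (p + t *: (r - p)) = q p - t * ((r F - p F) + c (r F - p F)) +
      t ^+ 2 * \sum_(y <- s) `|r y - p y| ^+ 2.
    have -> : r F - p F = \sum_(y <- s) c (g y - p y) * (r y - p y).
      by rewrite !hF -sumrB; apply: eq_bigr => y _; rewrite mulrBr.
    rewrite (big_morph c cD c0) -big_split/= !mulr_sumr /q -sumrB -big_split /=.
    apply: eq_bigr => y _; rewrite -!cN.
    have -> : g y - dual_fun (p + t *: (r - p)) y = (g y - p y) - t * (r y - p y).
      by rewrite -[dual_fun (_ + _) y]/(p y + t * (r y - p y)) opprD addrA.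
    by rewrite !(cB, cM) !cK (cR t)//; ring.
  have pF : p F = g F - q p.
    rewrite !hF /q -sumrB; apply: eq_bigr => y _.
    by rewrite -cN [_ * c _]mulrC -mulrBr subKr.
  have S2 : 1 <= (r F - p F) + c (r F - p F).
    rewrite pF !cB (cR (r F))// (cR (q p)) ?ger0_real//.
    have gF : g F + c (g F) <= 2 * `|F|.
      rewrite (le_trans (real_ler_norm (cr _)))// (le_trans (ler_normD _ _))//.
      by rewrite cnorm mulr_natl mulr2n lerD// dual_ball_le.
    have -> : r F - (g F - q p) + (r F - (c (g F) - q p)) =
       2 * r F + 2 * q p - (g F + c (g F)) by ring.
    rewrite lerBrDr (le_trans (lerD (lexx _) gF))//.
    have -> : 1 + 2 * `|F| = 2 * (`|F| - 2^-1) + 2 * 1 :> K by field.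
    by rewrite lerD// ler_wpM2l// nq.
  rewrite qE -addrA lerD2l -lerBrDl opprK.
  have bB : \sum_(y <- s) `|r y - p y| ^+ 2 <= B.
    apply: ler_sum => y _; rewrite ler_sqr ?nnegrE// ?mulr_ge0//.
    rewrite (le_trans (ler_normB _ _))// mulr_natl mulr2n lerD//;
      apply: dual_ball_le; exact: Pball.
  rewrite expr2 -mulrA.
  have := ler_wpM2l (ltW t0) (ler_wpM2l (ltW t0) bB) => /le_trans; apply.
  apply: (le_trans tB).
  have {1}-> : t * 2^-1 = t * 1 - t * 2^-1 by field.
  by rewrite addrC lerD2l ler_wpM2l// ltW.
have [p0 Pp0 _] := Pnorm 0 1 ltr01.
have dec n : exists2 p, P p & q p <= q p0 - n%:R * (t * 2^-1).
  elim: n => [|n [p Pp qp]]; first by exists p0; rewrite // mul0r subr0.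
  have [p' Pp' qp'] := step p Pp; exists p' => //.
  by rewrite (le_trans qp')// -[n.+1%:R]natr1 mulrDl mul1r opprD addrA lerD2r.
have k0 : 0 < t * 2^-1 by apply: mulr_gt0; rewrite ?t0 ?invr_gt0.
have [n] := scalar_arch (q p0 / (t * 2^-1)) (@real_or_complexP K).
rewrite ger0_norm; last by rewrite divr_ge0// ltW.
rewrite (ler_pdivrMr _ _ k0) => qn.
have [p Pp /(le_trans (nq p Pp))] := dec n.
by rewrite lerBrDl => /le_trans/(_ qn); rewrite gerDl lt_geF.
Qed.

(** The form in which the hypothesis is used: at a point of continuity,
    pointwise convergence inside the ball forces convergence against every
    element of the bidual. *)
Lemma PC_cvg (K : scalarFieldType) (Y : normedModType K) (g : dual Y)
    (F : set_system (dual Y)) (Theta : dual (dual Y)) : weakstar_weak_PC g ->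
  Filter F -> F (@dual_ball K Y) ->
  (forall y, (fun h : dual Y => h y : K^o) @ F --> (g y : K^o)) ->
  (Theta : dual Y -> K^o) @ F --> (Theta g : K^o).
Proof.
move=> [_ gPC] FF Fball Fg.
have wg : F --> (g : weakstar_top Y) by apply/weakstar_cvgP.
have TP := (iffLR (@weak_cvgP K (dual Y) _ g _) gPC) Theta.
move=> A /TP nA.
have FA := wg _ nA.
rewrite /fmap /=; apply: filterS2 Fball FA => h hb; exact.
Qed.

(** * Urysohn functions and isolated points *)

(** Urysohn functions with values in the scalar field, obtained over the
    underlying real field and embedded when the scalars are complex. *)
Lemma scalar_urysohn (K : numFieldType) (T : topologicalType) (A B : set T) :
  real_or_complex K -> normal_space T -> closed A -> closed B -> A `&` B = set0 ->
  exists h : T -> K, [/\ continuous (h : T -> K^o), forall w, 0 <= h w <= 1,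
    forall w, A w -> h w = 0 & forall w, B w -> h w = 1].
Proof.
move=> KP nT cA cB AB; case: K / KP => R.
  have /(@uniform_separatorP T R)[h [ch h01 hA hB]] := normal_uniform_separator nT cA cB AB.
  exists h; split=> [|w|w Aw|w Bw]; first exact: ch.
  - by have := h01 (h w) (imageT h w); rewrite /= in_itv.
  - by apply: hA; exists w.
  - by apply: hB; exists w.
have /(@uniform_separatorP T R)[h [ch h01 hA hB]] := normal_uniform_separator nT cA cB AB.
exists (fun w => (h w)%:C%C); split=> [w|w|w Aw|w Bw].
- apply/(@cvgrPdist_lt R[i] R[i]^o) => e e0.
  have [er|] := boolP (0 < complex.Re e); last first.
    by move: e0; rewrite ltcE => /andP[_ ->].
  have eE : e = (complex.Re e)%:C%C.
    by move: e0; rewrite ltcE => /andP[/eqP + _]; case: e {er} => a b /= ->.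
  have /cvgrPdist_lt/(_ _ er) := ch w; apply: filterS => v hv.
  by rewrite -rmorphB/= normc_def/= expr0n addr0 sqrtr_sqr eE ltcR.
- have := h01 (h w) (imageT h w); rewrite /= in_itv/= => /andP[h0 h1].
  by rewrite !lecR h0.
- by rewrite (hA (h w)) //; exists w.
- by rewrite (hB (h w)) //; exists w.
Qed.

Lemma infinite_compact_nonisolated (T : topologicalType) : compact [set: T] ->
  infinite_set [set: T] -> exists w : T, ~ isolated [set: T] w.
Proof.
move=> cT infT; apply: contrapT => /forallNP niso; apply: infT.
have op (w : T) : nbhs w [set w].
  have /contrapT[_ [V nV]] := niso w; rewrite setIT => VE.
  by rewrite -VE.
(* Finite sets of points, ordered by inclusion; compactness makes a single one
   contain every point. *)
pose F : set_system (seq T) :=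
  [set A | exists G : seq T, forall G' : seq T, {subset G <= G'} -> A G'].
have FF : Filter F.
  split=> [|A B [G GA] [G' GB]|A B AB [G GA]].
  - by exists [::].
  - exists (G ++ G') => H GH; split; [apply: GA|apply: GB] => w wG; apply: GH.
      by rewrite mem_cat wG.
    by rewrite mem_cat wG orbT.
  - by exists G => G' GG'; apply: AB; exact: GA.
have /compact_near_coveringP/(_ _ F (fun (G : seq T) w => w \in G) FF) := cT.
case=> [w _|G GT].
  exists ([set w], [set G : seq T | w \in G]).
    by split; [exact: op|exists [:: w] => G; apply; rewrite inE].
  by move=> [v G] /= [-> ].
apply: (sub_finite_set _ (finite_seq G)) => w _.
exact: (GT G).
Qed.

(** * Smallness off a finite set *)

(** The unit ball of [Y] is relatively compact in the bidual for the topology of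
    pointwise convergence on the dual. This produces the elements of the bidual
    against which points of continuity are tested. *)
Lemma bidual_ultralimit (K : scalarFieldType) (Y : normedModType K) (U : set_system Y) :
  UltraFilter U -> U [set y | `|y| <= 1] ->
  exists Theta : dual (dual Y), forall g : dual Y, (g : Y -> K^o) @ U --> (Theta g : K^o).
Proof.
move=> UU U1.
have gU (g : dual Y) : U [set y | `|g y| <= `|g|].
  apply: filterS U1 => y /= y1.
  by rewrite (le_trans (dual_le g y))// ler_piMr// dual_norm_ge0.
have /choice[l lP] : forall g : dual Y, exists l : K, (g : Y -> K^o) @ U --> (l : K^o).
  by move=> g; exact: (@bounded_ultralimit K Y U g `|g| (@real_or_complexP K) UU (gU g)).
have lin : (l : dual Y -> K^o) \in @dual_pred K (dual Y).
  apply: (@bounded_dual_pred K (dual Y) l 1).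
  - move=> a g h; apply: (@cvg_unique K^o _ (((a *: g + h : dual Y) : Y -> K^o) @ U)) => //.
      exact: lP.
    have -> : ((a *: g + h : dual Y) : Y -> K^o) = (fun y => a *: (g y : K^o) + h y) by [].
    by apply: (@cvgD K K^o) => //; exact: (@cvgZl_tmp K K^o).
  - move=> g; rewrite mul1r; apply/ler_addgt0Pr => e e0.
    have /cvgrPdist_le/(_ e e0) := lP g; move=> /(filterI (gU g))/filter_ex[y /= [gy ly]].
    by rewrite -[l g](subrK (g y)) addrC (le_trans (ler_normD _ _))// lerD.
by exists (Dual lin).
Qed.

Section WC.
Variables (K : scalarFieldType) (O : compactType) (X : normedModType K).
Implicit Types (f : WC O X) (w : O) (g : dual X).

Lemma WC_ballP f : `|f| <= 1 <-> forall w, `|f w| <= 1.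
Proof.
split=> [f1 w|f1]; last exact: WC_norm_le.
exact: le_trans (WC_norm_ge f w) f1.
Qed.

Lemma delta_tensor_norm_le w g : `|delta_tensor (X := X) w g| <= `|g|.
Proof.
apply: dual_norm_le => // f; rewrite (le_trans (dual_norm_ge g (f w)))//.
by rewrite ler_wpM2l ?dual_norm_ge0// WC_norm_ge.
Qed.

Lemma WC_norm_almost_attained f (e : K) : [set: O] !=set0 -> 0 < e ->
  exists w, `|f| - e <= `|f w|.
Proof.
move=> [w0 _] e0; apply: contrapT => /forallNP nw.
have : `|f| <= `|f| - e.
  have r : `|f| - e \is Num.real by rewrite rpredB ?normr_real ?gtr0_real.
  have nw' w : `|f w| <= `|f| - e.
    apply: ltW; rewrite real_ltNge ?normr_real//; exact/negP.
  by apply: WC_norm_le => //; exact: le_trans (nw' w0).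
by rewrite lerBrDr gerDl lt_geF.
Qed.

(** Suppose that for every finite [G] in [D] some [f_G] in the ball vanishes on
    [G] while [|Lam f_G| > e]. An ultralimit [Theta] of the [f_G] in the bidual
    kills every [delta_tensor w g] with [w] in [D]. By density of [D], weak
    continuity of the functions and Hahn-Banach, those of norm at most [1] norm
    the space, hence so does the convex set of the functionals in the ball killed
    by [Theta], which is then weak-star dense in the ball. As [Lam] is a point of
    continuity, [Theta Lam = 0], a contradiction. *)
Lemma PC_small_off_dense (D : set O) (Lam : dual (WC O X)) (e : K) : [set: O] !=set0 ->
  weakstar_weak_PC Lam -> (forall w B, nbhs w B -> exists2 v, D v & B v) -> 0 < e ->
  exists2 G : seq O, forall w, w \in G -> D w &
    forall f, `|f| <= 1 -> (forall w, w \in G -> f w = 0) -> `|Lam f| <= e.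
Proof.
move=> O0 LPC dD e0; apply: contrapT => /forall2NP nG.
pose BF : set_system (WC O X) := [set A | exists2 G : seq O, forall w, w \in G -> D w &
  forall f, `|f| <= 1 -> (forall w, w \in G -> f w = 0) -> ~ `|Lam f| <= e -> A f].
have FBF : ProperFilter BF.
  split.
    move=> [G DG GF]; have [//|] := nG G; apply => f f1 f0.
    by apply: contrapT => Lf; exact: GF f1 f0 Lf.
  split=> [|A B [G DG GA] [G' DG' GB]|A B AB [G DG GA]].
  - by exists [::].
  - exists (G ++ G') => [w|f f1 f0 Lf]; first by rewrite mem_cat => /orP[/DG|/DG'].
    split; [apply: GA => //|apply: GB => //] => w wG; apply: f0.
      by rewrite mem_cat wG.
    by rewrite mem_cat wG orbT.
  - by exists G => // f f1 f0 Lf; apply: AB; exact: GA.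
have [U [UU BU]] := ultraFilterLemma FBF.
have U1 : U [set f | `|f| <= 1] by apply: BU; exists [::].
have UL : U [set f | ~ `|Lam f| <= e] by apply: BU; exists [::].
have [Theta TP] := bidual_ultralimit UU U1.
have T0 w g : D w -> Theta (delta_tensor w g) = 0.
  move=> Dw; apply: (@cvg_unique K^o _ ((delta_tensor w g : WC O X -> K^o) @ U)) => //.
    exact: TP.
  apply: (@cvg_near_cst _ K^o) => //; apply: BU; exists [:: w] => [v|f _ f0 _ /=].
    by rewrite inE => /eqP ->.
  by rewrite -[LHS]/(g (f w)) f0 ?inE// linear0.
pose P : set (dual (WC O X)) := [set h | dual_ball h /\ Theta h = 0].
have Pconv p r (t : K) : 0 <= t <= 1 -> P p -> P r -> P (p + t *: (r - p)).
  move=> /andP[t0 t1] [p1 pT] [r1 rT]; split; last first.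
    by rewrite addrC dual_linear (addrC r) -scaleN1r dual_linear pT rT !(scaler0, addr0).
  rewrite /dual_ball /= scalerBr addrA addrAC -[X in X - _]scale1r -scalerBl.
  rewrite (le_trans (ler_normD _ _))// !normrZ !ger0_norm ?subr_ge0//.
  rewrite -[leRHS](subrK t) lerD//.
    by rewrite ler_piMr// subr_ge0.
  by rewrite ler_piMr.
have Pnorm (f : WC O X) (r : K) : 0 < r -> exists2 p, P p & `|f| - r <= p f.
  move=> r0; have r2 : 0 < r / 2 by rewrite divr_gt0.
  have [w fw] := WC_norm_almost_attained f O0 r2.
  have [x' [x'1 x'w]] := hahn_banach (f w).
  have /weak_continuousP/(_ x' w)/cvgrPdist_le/(_ _ r2) := @WC_continuous K O X f.
  move=> /(dD w)[v Dv]; rewrite /= x'w => fv.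
  have [a a1 ax] := scalar_phase (x' (f v)).
  exists (delta_tensor v (a *: x')).
    split; last exact: T0.
    rewrite /dual_ball /= (le_trans (delta_tensor_norm_le _ _))// normrZ mulr_ile1//.
    by apply: dual_norm_le => // y; rewrite mul1r.
  rewrite -[dual_fun _ f]/(a * x' (f v)) ax.
  rewrite lerBlDr; have := fw; rewrite lerBlDr => /le_trans; apply.
  rewrite [X in _ <= _ + X]splitr addrA lerD2r.
  have := ler_normD (`|f w| - x' (f v)) (x' (f v)); rewrite subrK normr_id.
  by move=> /le_trans; apply; rewrite [leLHS]addrC lerD2l.
have L1 := LPC.1.
have PB : P `<=` @dual_ball K (WC O X) by move=> p [].
have bip (s : seq (WC O X)) : exists2 p, P p & forall f, f \in s -> `|p f - Lam f| < 1.
  exact: bipolar.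
(* The trace on [P] of the weak-star neighbourhood filter of [Lam]. *)
pose F : set_system (dual (WC O X)) := [set A | exists s : seq (WC O X),
  forall p, P p -> (forall f, f \in s -> `|p f - Lam f| < 1) -> A p].
have FF : ProperFilter F.
  split; first by move=> [s Fs]; have [p Pp pL] := bip s; exact: Fs pL.
  split=> [|A B [s As] [s' Bs']|A B AB [s As]].
  - by exists [::].
  - exists (s ++ s') => p Pp ps; split; [apply: As => //|apply: Bs' => //] => f fs.
      by apply: ps; rewrite mem_cat fs.
    by apply: ps; rewrite mem_cat fs orbT.
  - by exists s => p Pp ps; apply: AB; exact: As.
have FP : F P by exists [::].
have Fcvg f : (fun h : dual (WC O X) => h f : K^o) @ F --> (Lam f : K^o).
  apply/cvgrPdist_le => r r0; exists [:: r^-1 *: f] => p Pp /(_ (r^-1 *: f)).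
  rewrite inE eqxx => /(_ isT); rewrite !dualZ -mulrBr normrM gtr0_norm ?invr_gt0//.
  by rewrite ltr_pdivrMl// mulr1 distrC => /ltW.
have TF : (Theta : dual (WC O X) -> K^o) @ F --> (Theta Lam : K^o).
  apply: PC_cvg => //; by apply: filterS FP => p [].
have TL0 : Theta Lam = 0.
  apply: (@cvg_unique K^o _ ((Theta : dual (WC O X) -> K^o) @ F)) => //.
  by apply: (@cvg_near_cst _ K^o); apply: filterS FP => p [].
have /cvgrPdist_lt/(_ e e0) := TP Lam; move=> /(filterI UL)/filter_ex[f /= [Lf]].
by rewrite TL0 sub0r normrN => /ltW.
Qed.

Lemma WC_of_fun (f : O -> X) : (forall g, continuous (g \o f : O -> K^o)) ->
  exists f' : WC O X, f' = f :> (O -> X).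
Proof. by move=> /weak_continuousP fc; exists (MkWC (mem_set fc)). Qed.

Lemma WC_mul (h : O -> K) f : continuous (h : O -> K^o) ->
  exists f' : WC O X, forall w, f' w = h w *: f w.
Proof.
move=> ch; have [g w|f' f'E] := @WC_of_fun (fun w => h w *: f w).
  have -> : g \o (fun w => h w *: f w) = (fun w => h w *: (g (f w) : K^o)).
    by apply/funext => v /=; rewrite dualZ.
  apply: (@cvgZ K K^o); first exact: ch.
  by have /weak_continuousP/(_ g w) := @WC_continuous K O X f.
by exists f' => w; rewrite f'E.
Qed.

Lemma WC_scalar (h : O -> K) (x : X) : continuous (h : O -> K^o) ->
  exists f' : WC O X, forall w, f' w = h w *: x.
Proof.
move=> ch; have [g w|c cE] := @WC_of_fun (fun _ => x); first exact: cst_continuous.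
by have [f' f'E] := WC_mul c ch; exists f' => w; rewrite f'E cE.
Qed.

Lemma finite_urysohn (A B : seq O) : hausdorff_space O ->
  (forall w, w \in A -> w \notin B) ->
  exists h : O -> K, [/\ continuous (h : O -> K^o), forall w, 0 <= h w <= 1,
    forall w, w \in A -> h w = 0 & forall w, w \in B -> h w = 1].
Proof.
move=> OH AB; have nO := compact_normal OH (@compact_setT O).
have cl (C : seq O) : closed [set` C].
  have /accessible_finite_set_closed := hausdorff_accessible OH; apply.
  exact: finite_seq.
have [|h [ch h01 hA hB]] := scalar_urysohn (@real_or_complexP K) nO (cl A) (cl B).
  by apply/seteqP; split=> // w [/= /AB/negP].
by exists h.
Qed.

(** A finite set [F] off which [Lam] is small is first found without regard to
    isolation. If [N] is its non-isolated part then the complement of [N] is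
    dense, hence also contains a finite set [G] off which [Lam] is small. For
    [f] vanishing on the isolated part of [F] and for a Urysohn function [h]
    equal to [1] on [N] and to [0] on [G], the function [(1 - h) f] vanishes on
    [F] and [h f] vanishes on [G]. *)
Lemma PC_small_off_isolated (Lam : dual (WC O X)) (e : K) : [set: O] !=set0 ->
  hausdorff_space O -> weakstar_weak_PC Lam -> 0 < e ->
  exists2 G : seq O, forall w, w \in G -> isolated [set: O] w &
    forall f, `|f| <= 1 -> (forall w, w \in G -> f w = 0) -> `|Lam f| <= e.
Proof.
move=> O0 OH LPC e0; have e2 : 0 < e / 2 by rewrite divr_gt0.
have [|F _ FP] := @PC_small_off_dense [set: O] Lam (e / 2) O0 LPC _ e2.
  by move=> w B /nbhs_singleton; exists w.
pose N := [seq w <- F | ~~ `[< isolated [set: O] w >]].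
have [|G GN GP] := @PC_small_off_dense [set w | w \notin N] Lam (e / 2) O0 LPC _ e2.
  move=> w B wB; have [wN|] := boolP (w \in N); last by exists w => //; exact: nbhs_singleton.
  apply: contrapT => /forall2NP nB.
  move: wN; rewrite mem_filter => /andP[/negP + _]; apply; apply/asboolP; split.
    by rewrite inE.
  have clN : closed [set` [seq v <- N | v != w]].
    have /accessible_finite_set_closed := hausdorff_accessible OH; apply.
    exact: finite_seq.
  have wN' : nbhs w (~` [set` [seq v <- N | v != w]]).
    by apply: open_nbhs_nbhs; split; [exact: closed_openC|rewrite /= mem_filter eqxx].
  exists (B `&` ~` [set` [seq v <- N | v != w]]); first exact: filterI.
  rewrite setIT; apply/seteqP; split=> [v /= [Bv]|v /= ->]; last first.
    by split; [exact: nbhs_singleton|rewrite mem_filter eqxx].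
  have [/negP/negPn vN|//] := nB v.
  by rewrite mem_filter vN andbT => /negP/negPn/eqP.
have [|h [ch h01 hG hN]] := @finite_urysohn G N OH; first exact: GN.
exists [seq w <- F | `[< isolated [set: O] w >]].
  by move=> w; rewrite mem_filter => /andP[/asboolP].
move=> f f1 f0.
have [k kE] := WC_mul f ch.
have h1 w : `|h w| <= 1 by have /andP[hw ?] := h01 w; rewrite ger0_norm.
have h1' w : `|1 - h w| <= 1.
  by have /andP[hw ?] := h01 w; rewrite ger0_norm ?subr_ge0// gerBl.
have fw w : `|f w| <= 1 by move: w; exact/WC_ballP.
rewrite -(subrK k f) dualD (le_trans (ler_normD _ _))// [e]splitr lerD//.
  have fkE w : (f - k) w = (1 - h w) *: f w.
    by rewrite -[LHS]/(f w - k w) kE scalerBl scale1r.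
  apply: FP => [|w wF]; first by apply/WC_ballP => w; rewrite fkE normrZ mulr_ile1 ?h1' ?fw.
  rewrite fkE; have [iw|niw] := pselect (isolated [set: O] w).
    by rewrite f0 ?scaler0// mem_filter wF andbT; apply/asboolP.
  by rewrite hN ?subrr ?scale0r// mem_filter wF andbT; apply/negP => /asboolP.
apply: GP => [|w wG]; last by rewrite kE hG ?scale0r.
by apply/WC_ballP => w; rewrite kE normrZ mulr_ile1 ?h1 ?fw.
Qed.
End WC.

(** * Spreading points of continuity *)

(** Points of continuity can be pulled back along an affine map [T] between the
    dual balls that is weak-star continuous and through which every element of
    the bidual of [Z] factors: the latter makes weak convergence of the images
    imply weak convergence. *)
Lemma PC_transfer (K : scalarFieldType) (Y Z : normedModType K) (g : dual Y) (h : dual Z)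
    (T : dual Z -> dual Y) :
  weakstar_weak_PC g -> dual_ball h -> T h = g ->
  (forall p, dual_ball p -> dual_ball (T p)) ->
  (forall y, exists z b, forall p, T p y = p z + b) ->
  (forall Xi : dual (dual Z), exists (Theta : dual (dual Y)) (a b : K),
    forall p, Xi p = a * Theta (T p) + b) ->
  weakstar_weak_PC h.
Proof.
move=> gPC h1 Th Tball Tws Tw; split=> //.
pose G : set_system (dual Z) := within (@dual_ball K Z) (nbhs (h : weakstar_top Z)).
have FG : Filter G by exact: within_filter.
apply/weak_cvgP => Xi; have [Theta [a [b XiE]]] := Tw Xi.
have hz z : (fun p : dual Z => p z : K^o) @ G --> (h z : K^o).
  have := iffLR (@weakstar_cvgP K Z (nbhs (h : weakstar_top Z)) h (nbhs_filter _))
    (fun A hA => hA) z.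
  move=> hA A /hA nA.
  by apply: (@filterS _ (nbhs (h : weakstar_top Z)) _ _ _ _ nA) => p pA _.
have Tg y : (fun p : dual Y => p y : K^o) @ (T @ G) --> (g y : K^o).
  have [z [c Tz]] := Tws y; rewrite -Th Tz.
  have -> : (fun p : dual Y => p y : K^o) @ (T @ G) = (fun p : dual Z => p z + c : K^o) @ G.
    by rewrite -fmap_comp; congr (fmap _ G); apply/funext => p /=; rewrite Tz.
  by apply: (@cvgD K K^o); [exact: hz|exact: cvg_cst].
have TB : (T @ G) (@dual_ball K Y).
  have GB : G (@dual_ball K Z) by exact: withinT.
  by apply: (@filterS _ G _ _ _ _ GB) => p /Tball.
have := @PC_cvg K Y g (T @ G) Theta gPC _ TB Tg.
have XiH : Xi h = a *: (Theta g : K^o) + b by rewrite XiE Th.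
rewrite XiH; have -> : (Xi : dual Z -> K^o) = (fun p => a *: (Theta (T p) : K^o) + b).
  by apply/funext => p; rewrite XiE.
move=> Tc; apply: (@cvgD K K^o); last exact: cvg_cst.
by apply: (@cvgZl_tmp K K^o); apply: Tc.
Qed.

(** Around an interior point [g] of the ball there is room for a small copy of
    the whole ball, so that continuity at [g] spreads to every point. *)
Lemma PC_interior (K : scalarFieldType) (Y : normedModType K) (g h : dual Y) :
  weakstar_weak_PC g -> `|g| < 1 -> dual_ball h -> weakstar_weak_PC h.
Proof.
move=> gPC g1 h1; pose t : K := (1 - `|g|) / 2.
have t0 : 0 < t by rewrite divr_gt0// subr_gt0.
apply: (@PC_transfer K Y Y g h (fun p => g + t *: (p - h))) => // [|p p1|y|Xi].
- by rewrite subrr scaler0 addr0.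
- rewrite /dual_ball /= (le_trans (ler_normD _ _))// -lerBrDl normrZ gtr0_norm//.
  rewrite /t mulrAC ler_pdivrMr// ler_wpM2l//; first by rewrite subr_ge0 ltW.
  by rewrite (le_trans (ler_normB _ _))// mulr2n lerD.
- exists (t *: y), (g y - t * h y) => p; rewrite dualZ.
  by rewrite -[LHS]/(g y + t * (p y - h y)); ring.
- exists Xi, t^-1, (Xi h - t^-1 * Xi g) => p.
  by rewrite dualD dualZ dualB; field; rewrite gt_eqF.
Qed.

(** * Atoms at isolated points *)

Section atoms.
Variables (K : scalarFieldType) (O : compactType) (X : normedModType K).
Implicit Types (f : WC O X) (w v : O) (g : dual X) (M : dual (WC O X)) (x : X) (t : K).

(** The function equal to [x] at [w] and to [0] elsewhere. The test on [w] makes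
    it continuous for every [w], so that [spike] and [atom] are total. *)
Definition spike_fun w x : O -> X :=
  fun v => if `[< clopen [set w] >] && (v == w) then x else 0.

Fact spike_subproof w x : spike_fun w x \in @WC_pred K O X.
Proof.
apply/mem_set/weak_continuousP => g v; rewrite /spike_fun.
case: asboolP => [[ow cw]|_] /=; last exact: cvg_cst.
apply: (@cvg_near_cst _ K^o) => /=.
have [->|/eqP vw] := eqVneq v w.
  by apply: (@filterS _ _ _ [set w]); [move=> u -> /=; rewrite eqxx|exact: open_nbhs_nbhs].
apply: (@filterS _ _ _ (~` [set w])) => [u /eqP/negbTE -> //|].
by apply: open_nbhs_nbhs; split=> //; exact: closed_openC.
Qed.

Definition spike w x : WC O X := MkWC (spike_subproof w x).

Lemma spikeE w x v : clopen [set w] -> spike w x v = if v == w then x else 0.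
Proof. by move=> cw; rewrite /= /spike_fun asboolT. Qed.

Lemma spike_linear w t x x' : spike w (t *: x + x') = t *: spike w x + spike w x'.
Proof.
apply/val_inj/funext => v.
rewrite -[RHS]/(t *: spike_fun w x v + spike_fun w x' v) /= /spike_fun.
by case: ifP => _ //; rewrite scaler0 addr0.
Qed.

Lemma spike_norm w x : `|spike w x| <= `|x|.
Proof.
by apply: WC_norm_le => // v; rewrite /= /spike_fun; case: ifP => _; rewrite ?normr0.
Qed.

Fact atom_subproof M w : (fun x => M (spike w x) : K^o) \in @dual_pred K X.
Proof.
apply: (@bounded_dual_pred K X (fun x => M (spike w x)) `|M|) => [t x x'|x].
  by rewrite spike_linear dualD dualZ.
by rewrite (le_trans (dual_le M _))// ler_wpM2l ?spike_norm.
Qed.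

(** For an isolated point [w], the component of [M] in the l1-summand of the dual
    that is carried by [w]. *)
Definition atom M w : dual X := Dual (atom_subproof M w).

Lemma atom_norm_le M w : `|atom M w| <= `|M|.
Proof.
apply: dual_norm_le => // x.
by rewrite (le_trans (dual_le M _))// ler_wpM2l ?spike_norm.
Qed.

Lemma atom_linear M M' w t : atom (t *: M + M') w = t *: atom M w + atom M' w.
Proof. exact/val_inj/funext. Qed.

Lemma atom_delta_tensor w v g : clopen [set w] ->
  atom (delta_tensor v g) w = if v == w then g else 0.
Proof.
move=> cw; apply/val_inj/funext => x.
rewrite -[LHS]/(g (spike w x v)) spikeE//.
by case: ifP => //; rewrite linear0.
Qed.

(** [WC O X] is the sup-norm direct sum of [X], carried by the point [w], and of
    the functions vanishing at [w]; its dual is the corresponding l1-sum. *)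
Lemma atom_norm_split M w : clopen [set w] ->
  `|atom M w| + `|M - delta_tensor w (atom M w)| <= `|M|.
Proof.
move=> cw; rewrite -lerBrDl; apply: dual_norm_le_ball => f f1.
rewrite lerBrDl -lerBrDr; apply: dual_norm_le_ball => x x1; rewrite lerBrDr.
pose f' := f - spike w (f w).
have [a a1 aM] := scalar_phase (M (spike w x)); have [b b1 bM] := scalar_phase (M f').
have -> : `|atom M w x| = a * M (spike w x) by rewrite aM.
have -> : `|(M - delta_tensor w (atom M w)) f| = b * M f'.
  by rewrite bM /f' dualB.
rewrite -!dualZ -dualD.
have abr : M (a *: spike w x + b *: f') \is Num.real.
  by rewrite dualD !dualZ aM bM rpredD ?normr_real.
rewrite (le_trans (real_ler_norm abr))// (le_trans (dual_le M _))// ler_piMr//.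
apply/WC_ballP => v.
have -> : (a *: spike w x + b *: f') v = a *: spike w x v + b *: (f v - spike w (f w) v) by [].
rewrite !spikeE//; have [->|_] := eqVneq v w.
  by rewrite subrr scaler0 addr0 normrZ mulr_ile1.
rewrite scaler0 add0r subr0 normrZ mulr_ile1//; move: v; exact/WC_ballP.
Qed.

Lemma half_atom_norm M w : clopen [set w] ->
  2^-1 * `|atom M w| + `|M - 2^-1 *: delta_tensor w (atom M w)| = `|M|.
Proof.
move=> /(@atom_norm_split M) MM; have h0 : 0 <= 2^-1 :> K by rewrite invr_ge0.
apply/eqP; rewrite eq_le; apply/andP; split; last first.
  rewrite -[leLHS](congr1 _ (subrK (2^-1 *: delta_tensor w (atom M w)) M)).
  rewrite (le_trans (ler_normD _ _))// addrC lerD2r normrZ (ger0_norm h0).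
  by rewrite ler_wpM2l// delta_tensor_norm_le.
have -> : M - 2^-1 *: delta_tensor w (atom M w) =
    2^-1 *: M + 2^-1 *: (M - delta_tensor w (atom M w)).
  by rewrite scalerBr addrA -scalerDl [2^-1 + _](_ : _ = 1) ?scale1r//; field.
rewrite (le_trans (lerD (lexx _) (ler_normD _ _)))// !normrZ !(ger0_norm h0).
rewrite addrCA -mulrDr.
have {2}-> : `|M| = 2^-1 * `|M| + 2^-1 * `|M| by field.
by rewrite lerD2l ler_wpM2l.
Qed.

(** Replacing the atom of [M] at [w] by another functional of at most the same
    norm stays in the ball, since norms add up in the l1-sum, and [atom ^~ w]
    recovers the functional. *)
Lemma atom_PC M w : clopen [set w] -> weakstar_weak_PC M -> 0 < `|atom M w| ->
  weakstar_weak_PC (`|atom M w|^-1 *: atom M w).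
Proof.
move=> cw MPC; set a := `|atom M w| => a0.
pose M' := M - delta_tensor w (atom M w).
apply: (@PC_transfer K _ X M _ (fun p => delta_tensor w (a *: p) + M')) => //.
- by rewrite /dual_ball /= normrZ gtr0_norm ?invr_gt0// mulVf// gt_eqF.
- by rewrite scalerA divff ?gt_eqF// scale1r /M' addrC subrK.
- move=> p p1; rewrite /dual_ball /= (le_trans _ MPC.1)// (le_trans _ (atom_norm_split M cw))//.
  rewrite (le_trans (ler_normD _ _))// lerD2r (le_trans (delta_tensor_norm_le _ _))//.
  by rewrite normrZ gtr0_norm// ler_piMr// ltW.
- by move=> f; exists (a *: f w), (M' f) => p; rewrite dualZ.
move=> Xi.
have lin : ((fun p => Xi (atom p w)) : dual (WC O X) -> K^o) \in @dual_pred K (dual (WC O X)).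
  apply: (@bounded_dual_pred K _ (fun p => Xi (atom p w)) `|Xi|) => [t p p'|p].
    by rewrite atom_linear dualD dualZ.
  by rewrite (le_trans (dual_le Xi _))// ler_wpM2l ?atom_norm_le.
exists (Dual lin), a^-1, (- (a^-1 * Xi (atom M' w))) => p /=.
have -> : atom (delta_tensor w (a *: p) + M') w = a *: p + atom M' w.
  rewrite -[delta_tensor w _]scale1r atom_linear scale1r.
  by rewrite atom_delta_tensor// eqxx.
by rewrite dualD dualZ; field; rewrite gt_eqF.
Qed.

(** Subtracting from [f] its values at the points of [G] leaves a function in the
    ball that vanishes on [G]. *)
Lemma norm_le_atoms M (G : seq O) (e : K) : (forall w, w \in G -> clopen [set w]) ->
  (forall f, `|f| <= 1 -> (forall w, w \in G -> f w = 0) -> `|M f| <= e) ->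
  `|M| <= e + \sum_(w <- G) `|atom M w|.
Proof.
move=> cG Me; apply: dual_norm_le_ball => f f1.
have [f' f'E Mf] : exists2 f' : WC O X, forall v, f' v = if v \in G then 0 else f v &
    `|M f| <= `|M f'| + \sum_(w <- G) `|atom M w|.
  elim: G cG {Me} => [|w G IH] cG; first by exists f; rewrite ?big_nil ?addr0.
  have [v vG|f' f'E Mf] := IH; first by apply: cG; rewrite inE vG orbT.
  have cw : clopen [set w] by apply: cG; rewrite inE eqxx.
  exists (f' - spike w (f' w)) => [v|].
    rewrite -[LHS]/(f' v - spike w (f' w) v) spikeE// inE.
    by case: (eqVneq v w) => [->|_]; rewrite ?subrr// subr0 f'E.
  rewrite big_cons (le_trans Mf)// addrA lerD2r.
  rewrite -{1}(subrK (spike w (f' w)) f') dualD (le_trans (ler_normD _ _))// lerD2l.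
  rewrite -[M (spike _ _)]/(atom M w (f' w)) (le_trans (dual_le _ _))// ler_piMr//.
  rewrite f'E; case: ifP => _; first by rewrite normr0.
  by move: (w); exact/WC_ballP.
rewrite (le_trans Mf)// lerD2r Me// => [|w wG]; last by rewrite f'E wG.
apply/WC_ballP => v; rewrite f'E; case: ifP => _; first by rewrite normr0.
by move: (v); exact/WC_ballP.
Qed.

Lemma isolated_clopen w : hausdorff_space O -> isolated [set: O] w -> clopen [set w].
Proof.
move=> OH [_ [V nV]]; rewrite setIT => VE; split.
  by rewrite openE => _ ->; rewrite /interior -VE.
exact: accessible_closed_set1 (hausdorff_accessible OH) w.
Qed.

(** If [|M| < 1] then every point of the ball is a point of continuity, including
    [delta_tensor w g] for a non-isolated point [w] and [|g| = 1]. This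
    functional is not small on the functions in the ball that vanish on a given
    finite set of isolated points: some of them take at [w] a unit vector on
    which [g] is [1]. *)
Lemma PC_norm1 M : hausdorff_space O -> infinite_set [set: O] -> (exists x, x != 0) ->
  weakstar_weak_PC M -> `|M| = 1.
Proof.
move=> OH Oinf [x x0] MPC; have [w niw] := infinite_compact_nonisolated (@compact_setT O) Oinf.
apply/eqP; rewrite eq_le MPC.1 /= real_leNgt ?real1 ?normr_real//; apply/negP => M1.
have [g [g1 gx]] := hahn_banach x.
have gball : `|g| <= 1 by apply: dual_norm_le => // y; rewrite mul1r.
have dPC : weakstar_weak_PC (delta_tensor (O := O) w g).
  by apply: PC_interior MPC M1 _; exact: le_trans (delta_tensor_norm_le _ _) gball.
have h0 : 0 < 2^-1 :> K by rewrite invr_gt0.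
have [|G Giso GP] := PC_small_off_isolated _ OH dPC h0; first by exists w.
have [v vG|h [ch h01 hG hw]] := @finite_urysohn K O G [:: w] OH.
  by rewrite inE; apply/eqP => vw; apply: niw; rewrite -vw; exact: Giso.
have [f fE] := WC_scalar (`|x|^-1 *: x) ch.
have nx : `| `|x|^-1 *: x| = 1 by rewrite normrZ normfV normr_id mulVf ?normr_eq0.
have := GP f; rewrite -[dual_fun _ f]/(g (f w)) fE hw ?inE// scale1r dualZ gx.
rewrite mulVf ?normr_eq0// normr1 => H.
have : 1 <= 2^-1 :> K.
  apply: H => [|v vG]; last by rewrite fE hG ?scale0r.
  apply/WC_ballP => v; have /andP[hv ?] := h01 v.
  by rewrite fE normrZ nx mulr1 ger0_norm.
by rewrite invf_ge1// lt_geF ?ltr1n.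
Qed.
End atoms.

(** * Repeated halving of the atoms *)

(** Index [i] enumerates the entry coded by the exponent of [2] in [i.+1]; every
    exponent occurs for arbitrarily large [i]. *)
Lemma recurrent_enumeration (T : eqType) (A : nat -> seq T) (t0 : T) :
  exists s : nat -> T, (forall i, s i = t0 \/ exists n, s i \in A n) /\
    forall n t N, t \in A n -> exists2 i, (N <= i)%N & s i = t.
Proof.
pose e (p : nat) : T := if unpickle p is Some (n, k) then nth t0 (A n) k else t0.
exists (fun i => e (logn 2 i.+1)); split=> [i|n t N tA].
  rewrite /e; case: unpickle => [[n k]|]; last by left.
  have [kA|kA] := ltnP k (size (A n)); last by left; rewrite nth_default.
  by right; exists n; exact: mem_nth.
pose p := pickle (n, index t (A n)).
exists (2 ^ p * N.*2.+1).-1.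
  rewrite -ltnS prednK ?muln_gt0 ?expn_gt0//.
  by rewrite (@leq_trans N.*2.+1)// ?leq_pmull ?expn_gt0// ltnS -addnn leq_addr.
rewrite prednK ?muln_gt0 ?expn_gt0// lognM ?expn_gt0// pfactorK//.
rewrite (@logn_coprime 2 N.*2.+1) ?addn0; last by rewrite coprime2n /= odd_double.
by rewrite /e pickleK nth_index.
Qed.

Section halving.
Variables (K : scalarFieldType) (T : eqType) (s : nat -> T).

(** The proportion of the mass at [t] that is left after [n] steps, when step [i]
    removes half of what is left at [s i]. *)
Definition halving n t : K := \prod_(i < n) (if s i == t then 2^-1 else 1).

Lemma halving0 t : halving 0 t = 1.
Proof. exact: big_ord0. Qed.

Lemma halvingS n t : halving n.+1 t = (if s n == t then 2^-1 else 1) * halving n t.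
Proof. by rewrite /halving big_ord_recr mulrC. Qed.

Let half_le1 : 2^-1 <= 1 :> K. Proof. by rewrite invf_le1// ler1n. Qed.

Lemma halving_gt0 n t : 0 < halving n t.
Proof. by apply: prodr_gt0 => i _; case: ifP => _; rewrite ?invr_gt0. Qed.

Lemma halving_le n m t : (n <= m)%N -> halving m t <= halving n t.
Proof.
move=> /subnK <-; elim: (m - n)%N => [|k IH]//; rewrite addSn halvingS.
by apply: le_trans IH; case: ifP => _; rewrite ?mul1r ?ler_piMl ?(ltW (halving_gt0 _ _)).
Qed.

Lemma halving_to0 t e : 0 < e -> (forall N, exists2 i, (N <= i)%N & s i = t) ->
  exists N, forall n, (N <= n)%N -> halving n t <= e.
Proof.
move=> e0 hit.
have small l : exists N, halving N t <= 2^-1 ^+ l.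
  elim: l => [|l [N Nl]]; first by exists 0; rewrite halving0.
  have [i Ni si] := hit N; exists i.+1; rewrite halvingS si eqxx exprS.
  by rewrite ler_wpM2l ?invr_ge0// (le_trans _ Nl)// halving_le.
have [l] := scalar_arch e^-1 (@real_or_complexP K).
rewrite gtr0_norm ?invr_gt0// => el; have [N Nl] := small l.
exists N => n /(halving_le t)/le_trans; apply; apply: (le_trans Nl).
rewrite exprVn -[e]invrK lef_pV2 ?posrE ?invr_gt0 ?exprn_gt0//.
by rewrite (le_trans el)// -natrX ler_nat ltnW// ltn_expl.
Qed.
End halving.

Section residual.
Variables (K : scalarFieldType) (O : compactType) (X : normedModType K).
Variables (L : dual (WC O X)) (s : nat -> O).
Hypothesis s_clopen : forall i, clopen [set s i].
Implicit Types (f : WC O X) (w v : O) (M : dual (WC O X)).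

(** What is left of [L] when step [i] removes half of the atom then present at
    [s i]. An atom is never exhausted, so that a sequence [s] of points carrying
    atoms of [L] removes something at every step, even if these atoms are
    finite in number. *)
Fixpoint residual n : dual (WC O X) := if n is m.+1 then
  residual m - 2^-1 *: delta_tensor (s m) (atom (residual m) (s m)) else L.

Lemma atom_residual n w : clopen [set w] ->
  atom (residual n) w = halving K s n w *: atom L w.
Proof.
move=> cw; elim: n => [|n IH] /=; first by rewrite halving0 scale1r.
rewrite addrC -scaleNr atom_linear atom_delta_tensor// halvingS.
case: eqP => [->|_]; last by rewrite scaler0 add0r mul1r.
rewrite IH -scalerA -[X in _ + X]scale1r -scalerDl; congr (_ *: _); by field.
Qed.

Lemma residual_sum n : L = residual n +
  \sum_(i < n) 2^-1 *: delta_tensor (s i) (atom (residual i) (s i)).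
Proof.
elim: n => [|n IH]; first by rewrite big_ord0 addr0.
by rewrite big_ord_recr/= [X in _ + X]addrC addrA subrK.
Qed.

(** The masses removed telescope because of the l1-decomposition. *)
Lemma residual_norm n :
  \sum_(i < n) 2^-1 * `|atom (residual i) (s i)| = `|L| - `|residual n|.
Proof.
elim: n => [|n IH]; first by rewrite big_ord0 subrr.
rewrite big_ord_recr/= IH -[in LHS](@half_atom_norm _ _ _ (residual n) (s n))//; ring.
Qed.

Lemma residual_vanish (G : seq O) (e : K) n :
  (forall f, `|f| <= 1 -> (forall w, w \in G -> f w = 0) -> `|L f| <= e) ->
  forall f, `|f| <= 1 -> (forall w, w \in G -> f w = 0) -> `|residual n f| <= e.
Proof.
move=> Le; elim: n => [//|n IH] f f1 f0.
have -> : residual n.+1 f = residual n (f - 2^-1 *: spike (s n) (f (s n))).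
  by rewrite dualB dualZ.
have fE w : (f - 2^-1 *: spike (s n) (f (s n))) w =
    (if w == s n then 2^-1 else 1) *: f w.
  rewrite -[LHS]/(f w - 2^-1 *: spike (s n) (f (s n)) w) spikeE//.
  case: eqP => [->|_]; last by rewrite scaler0 subr0 scale1r.
  by rewrite -[X in X - _]scale1r -scalerBl; congr (_ *: _); by field.
apply: IH => [|w wG]; last by rewrite fE f0 ?scaler0.
apply/WC_ballP => w; rewrite fE normrZ mulr_ile1//.
  by case: ifP => _; rewrite ?normr1// gtr0_norm ?invr_gt0// invf_le1// ler1n.
by move: w; exact/WC_ballP.
Qed.

(** Off a finite set [G] the residuals stay as small as [L] is, and on [G] the
    atoms decay since each nonzero one is halved infinitely often. *)
Lemma residual_to0 (e : K) (G : seq O) : 0 < e ->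
  (forall w, w \in G -> clopen [set w]) ->
  (forall f, `|f| <= 1 -> (forall w, w \in G -> f w = 0) -> `|L f| <= e / 2) ->
  (forall w N, w \in G -> atom L w != 0 -> exists2 i, (N <= i)%N & s i = w) ->
  exists N, forall n, (N <= n)%N -> `|residual n| <= e.
Proof.
move=> e0 cG LG hit.
suff [N NP] : exists N, forall n, (N <= n)%N ->
    \sum_(w <- G) `|atom (residual n) w| <= e / 2.
  exists N => n /NP nP; rewrite (le_trans (norm_le_atoms cG (@residual_vanish G _ n LG)))//.
  by rewrite [leRHS]splitr lerD2l.
have {e0}: 0 < e / 2 by rewrite divr_gt0.
move: (e / 2) => r r0 {LG}.
elim: G r r0 cG hit => [|w G IH] r r0 cG hit.
  by exists 0 => n _; rewrite big_nil ltW.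
have r2 : 0 < r / 2 by rewrite divr_gt0.
have [|v N' vG|N NP] := IH _ r2.
- by move=> v vG; apply: cG; rewrite inE vG orbT.
- by apply: hit; rewrite inE vG orbT.
have cw : clopen [set w] by apply: cG; rewrite inE eqxx.
have [aw|aw] := eqVneq (atom L w) 0.
  exists N => n Nn; rewrite big_cons atom_residual// aw scaler0 normr0 add0r.
  by rewrite (le_trans (NP n Nn))// ler_pdivrMr// ler_pMr// ler1n.
have aw0 : 0 < `|atom L w| by rewrite normr_gt0.
have [|N'|N' N'P] := @halving_to0 K O s w (r / 2 / `|atom L w|).
- by rewrite divr_gt0.
- by apply: hit => //; rewrite inE eqxx.
exists (maxn N N') => n; rewrite geq_max => /andP[Nn N'n].
rewrite big_cons [leRHS]splitr lerD ?NP// atom_residual// normrZ gtr0_norm ?halving_gt0//.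
by rewrite -ler_pdivlMr// N'P.
Qed.
End residual.

(** * The representation *)

Theorem theorem4p1 (K : scalarFieldType) (Omega : compactType)
    (X : completeNormedModType K)
    (Omega_hausdorff : hausdorff_space Omega)
    (Omega_infinite : infinite_set [set: Omega])
    (X_neq0 : exists x : X, x != 0)
    (Lambda : dual (WC Omega X)) (Lambda_PC : weakstar_weak_PC Lambda) :
  exists (alpha : nat -> K) (omega : nat -> Omega) (xs : nat -> dual X),
    [/\ forall i, 0 < alpha i <= 1,
        series alpha @ \oo --> (1 : K^o),
        forall i, weakstar_weak_PC (xs i),
        forall i, isolated [set: Omega] (omega i)
      & series (fun i => alpha i *: delta_tensor (omega i) (xs i)) @ \oo
          --> Lambda].
Proof.
have L1 : `|Lambda| = 1 by exact: PC_norm1.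
have Omega0 : [set: Omega] !=set0.
  by apply/set0P/eqP => O0; apply: Omega_infinite; rewrite O0; exact: finite_set0.
have iso_clopen w : isolated [set: Omega] w -> clopen [set w] by exact: isolated_clopen.
have F_ex (n : nat) : exists G : seq Omega, (forall w, w \in G -> isolated [set: Omega] w) /\
    forall f : WC Omega X, `|f| <= 1 -> (forall w, w \in G -> f w = 0) ->
      `|Lambda f| <= n.+1%:R^-1.
  have n0 : 0 < n.+1%:R^-1 :> K by rewrite invr_gt0.
  by have [G Giso GL] := PC_small_off_isolated Omega0 Omega_hausdorff Lambda_PC n0; exists G.
have /choice[F FP] := F_ex.
pose A n := [seq w <- F n | atom Lambda w != 0].
have A_iso n w : w \in A n -> isolated [set: Omega] w /\ atom Lambda w != 0.
  by rewrite mem_filter => /andP[? wF]; split=> //; exact: (FP n).1.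
have [w0 [n0 w0A]] : exists w0 n0, w0 \in A n0.
  apply: contrapT => /forallNP nA.
  have := norm_le_atoms (fun w wF => iso_clopen w ((FP 1%N).1 w wF)) (FP 1%N).2.
  rewrite big1_seq ?addr0 => [|w /= wF]; last first.
    apply/eqP; rewrite normr_eq0; apply/negPn/negP => aw.
    by apply: (nA w); exists 1%N; rewrite mem_filter aw.
  by rewrite L1 invf_ge1// lt_geF// ltr1n.
have [s [sA s_hit]] := recurrent_enumeration A w0.
have sP i : isolated [set: Omega] (s i) /\ atom Lambda (s i) != 0.
  by have [->|[n /A_iso]] := sA i; first exact: A_iso w0A.
have s_clopen i : clopen [set s i] by apply: iso_clopen; exact: (sP i).1.
have a0 i : 0 < `|atom Lambda (s i)| by rewrite normr_gt0; exact: (sP i).2.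
pose R := residual Lambda s.
have R_small (e : K) : 0 < e -> exists N, forall n, (N <= n)%N -> `|R n| <= e.
  move=> e0; have [n] := scalar_arch (e / 2)^-1 (@real_or_complexP K).
  rewrite gtr0_norm ?invr_gt0 ?divr_gt0// => en.
  have [Fiso FL] := FP n.
  apply: (residual_to0 s_clopen e0 (G := F n)) => [w /Fiso|f f1 f0|w N wF aw].
  - exact: iso_clopen.
  - rewrite (le_trans (FL f f1 f0))// -[leRHS]invrK lef_pV2 ?posrE ?invr_gt0 ?divr_gt0//.
    by rewrite (le_trans en)// ler_nat.
  - by apply: (s_hit n); rewrite mem_filter aw.
pose alpha i : K := 2^-1 * `|atom (R i) (s i)|.
pose xs i : dual X := `|atom Lambda (s i)|^-1 *: atom Lambda (s i).
have aR i : atom (R i) (s i) = halving K s i (s i) *: atom Lambda (s i).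
  exact: atom_residual.
have c0 i : 0 < halving K s i (s i) by exact: halving_gt0.
have alphaE i : alpha i = 2^-1 * (halving K s i (s i) * `|atom Lambda (s i)|).
  by rewrite /alpha aR normrZ (gtr0_norm (c0 i)).
(* Normalising the atom of [R i] gives the normalised atom of [Lambda]. *)
have term i : alpha i *: delta_tensor (s i) (xs i) =
    2^-1 *: delta_tensor (s i) (atom (R i) (s i)).
  apply/val_inj/funext => f; rewrite alphaE aR.
  set c := halving K s i (s i); set g := atom Lambda (s i).
  rewrite -[LHS]/(2^-1 * (c * `|g|) * (`|g|^-1 * g (f (s i)))).
  rewrite -[RHS]/(2^-1 * (c * g (f (s i)))).
  by field; rewrite gt_eqF// a0.
exists alpha, s, xs; split=> [i|||i|].
- have c1 : halving K s i (s i) <= 1.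
    by rewrite (le_trans (halving_le K s (s i) (leq0n i)))// halving0.
  have a1 : `|atom Lambda (s i)| <= 1 by rewrite -L1 atom_norm_le.
  have h1 : 2^-1 <= 1 :> K by rewrite invf_le1// ler1n.
  have h0 : 0 < 2^-1 :> K by rewrite invr_gt0.
  apply/andP; split; first by rewrite alphaE !mulr_gt0.
  by rewrite alphaE !mulr_ile1 ?mulr_ge0 ?(ltW (c0 i)) ?(ltW h0).
- apply/(@cvgrPdist_le K K^o) => e /R_small[N NR]; exists N => // n /= /NR Rn.
  by rewrite seriesEord/= residual_norm// L1 opprB addrCA subrr addr0 normr_id.
- by move=> i; exact: atom_PC.
- exact: (sP i).1.
- apply/cvgrPdist_le => e /R_small[N NR]; exists N => // n /= /NR Rn.
  rewrite seriesEord/=.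
  under eq_bigr do rewrite term.
  by rewrite [X in X - _](residual_sum Lambda s n) addrK.
Qed.
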